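(* Let $\alpha, \theta$ be nonconstant inner functions such that $\alpha$ divides $\theta$ and $\theta/\alpha$ is nonconstant, and let $A\colon K^2_\theta\to K^2_\alpha$ be a bounded operator satisfying $$A-S_\alpha^* A S_\theta=\mu\otimes \tilde{k}_0^\theta+\tilde{k}_0^\alpha\otimes \nu$$ for some $\mu\in K^2_\alpha$, $\nu\in K^2_\theta$. Then $A=A^{\theta,\alpha}_{\psi+\bar\chi}$, where $$\psi=C_\alpha P_\alpha(\nu- c\, \tilde k_0^\theta)= C_\alpha P_\alpha\nu-\bar c\,\overline{ \tfrac{\theta}{\alpha}(0)}\, k_0^\alpha\in K^2_\alpha$$ and $$\chi=S_{\frac{\theta}{\alpha}} P_{\frac{\theta}{\alpha}}\big(\bar\alpha(\nu- c\, \tilde k_0^\theta)\big)+\tfrac{\theta}{\alpha}C_\alpha(\mu+\bar c\,\tilde k_0^\alpha)=\Big(S_{\frac{\theta}{\alpha}} P_{\frac{\theta}{\alpha}}(\bar\alpha\nu)+ c\,\tfrac{ \theta}{\alpha}(0)\, k_0^{\frac{\theta}{\alpha}}\Big)+\tfrac{\theta}{\alpha}\big(C_\alpha\mu+ c\, k_0^\alpha\big)\in K^2_\theta=K^2_{\frac{\theta}{\alpha}}\oplus \tfrac{\theta}{\alpha}K^2_\alpha,$$ with $$c=\langle P_{\frac{\theta}{\alpha}}(\bar\alpha\nu),\tilde k_0^{\frac{\theta}{\alpha}}\rangle\, \|\tilde k_0^{\frac{\theta}{\alpha}}\|^{-2}.$$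
   Context: $L^2=L^2(\mathbb T,m)$ with $\mathbb T$ the unit circle and $m$ normalized Lebesgue measure; $H^2\subset L^2$ is the Hardy space of the unit disc. For an inner function $u$, $K^2_u=H^2\ominus uH^2$, $P_u\colon L^2\to K^2_u$ is the orthogonal projection, $k_0^u=1-\overline{u(0)}\,u$, $\tilde k_0^u=\bar z(u-u(0))$ (both in $K_u^2$), $C_u f=u\,\overline{z f}$ on $L^2$ (an antilinear isometric involution preserving $K_u^2$), and $S_u\colon K_u^2\to K_u^2$, $S_uf=P_u(zf)$. $\alpha$ divides $\theta$ means that $\theta/\alpha=\bar\alpha\theta$ is inner. $(x\otimes y)f=\langle f,y\rangle x$. For $\varphi\in L^2$, $A_\varphi^{\theta,\alpha}f=P_\alpha(\varphi f)$ with domain $\{f\in K^2_\theta:\varphi f\in L^2\}$, which contains the dense subspace $K^2_\theta\cap H^\infty$; if it is bounded, $A_\varphi^{\theta,\alpha}$ also denotes its unique bounded extension $K^2_\theta\to K^2_\alpha$. *)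

(* Defs.v *)
From HB Require Import structures.
From mathcomp Require Import all_boot all_order all_algebra.
From mathcomp Require Import all_classical all_reals all_analysis measurable_realfun complex.

Set Implicit Arguments.
Unset Strict Implicit.
Unset Printing Implicit Defensive.

Import Order.TTheory GRing.Theory Num.Theory.
Import numFieldNormedType.Exports.

Local Open Scope classical_set_scope.
Local Open Scope ring_scope.

Section circle.
Variable R : realType.

Record circle := Circle { circle_val :> R[i]; _ : `|circle_val| == 1 }.

HB.instance Definition _ := [isSub for circle_val].
HB.instance Definition _ := [Choice of circle by <:].

Lemma circle_param_subproof (t : R) :
  `|(cos (2 * pi * t) +i* sin (2 * pi * t))%C| == 1 :> R[i].
Proof. by rewrite normc_def /= cos2Dsin2 sqrtr1. Qed.

Definition circle_param (t : R) : circle := Circle (circle_param_subproof t).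

HB.instance Definition _ := isPointed.Build circle (circle_param 0).

(* The Borel sigma-algebra inherited from R[i], identified with R * R. *)
Definition circle_coord (z : circle) : R * R := (complex.Re z, complex.Im z).

Definition circle_measurable : set (set circle) :=
  preimage_set_system setT circle_coord measurable.

Let circle_sigma_algebra : sigma_algebra setT circle_measurable :=
  sigma_algebra_preimage setT circle_coord (sigma_algebra_measurable _).

Let circle_measurable0 : circle_measurable set0.
Proof. by case: circle_sigma_algebra. Qed.

Let circle_measurableC A : circle_measurable A -> circle_measurable (~` A).
Proof.
by case: circle_sigma_algebra => _ mC _ mA; rewrite -setTD; exact: mC.
Qed.

Let circle_measurable_bigcup (F : (set circle)^nat) :
  (forall i, circle_measurable (F i)) -> circle_measurable (\bigcup_i F i).
Proof. by case: circle_sigma_algebra => _ _; exact. Qed.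

HB.instance Definition _ := @isMeasurable.Build default_measure_display circle
  circle_measurable circle_measurable0 circle_measurableC
  circle_measurable_bigcup.

Lemma measurable_circle_param : measurable_fun setT circle_param.
Proof.
move=> _ A [B mB <-]; rewrite !setTI.
suff mf : measurable_fun setT (circle_coord \o circle_param).
  by have := mf measurableT B mB; rewrite setTI.
have mlin : measurable_fun setT (fun t : R => 2 * pi * t).
  exact: mulrl_measurable.
apply/measurable_fun_pairP; split.
  apply: (measurableT_comp (f := cos)) => //.
  by apply: continuous_measurable_fun; exact: continuous_cos.
apply: (measurableT_comp (f := sin)) => //.
by apply: continuous_measurable_fun; exact: continuous_sin.
Qed.

(* Normalized Lebesgue measure on the circle: the image of Lebesgue measure on
   [0, 1] under t |-> exp(2 pi i t). *)
Definition circle_measure : set circle -> \bar R :=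
  pushforward (mrestr (@lebesgue_measure R) (measurable_itv `[0, 1]))
    circle_param.

Let circle_measure0 : circle_measure set0 = 0%E.
Proof. by rewrite /circle_measure /pushforward preimage_set0 measure0. Qed.

Let circle_measure_ge0 A : (0 <= circle_measure A)%E.
Proof. by rewrite /circle_measure /pushforward; exact: measure_ge0. Qed.

Let circle_measure_sigma_additive : semi_sigma_additive circle_measure.
Proof.
move=> F mF tF mUF; rewrite /circle_measure /pushforward preimage_bigcup.
apply: measure_semi_sigma_additive.
- by move=> n; rewrite -[X in measurable X]setTI; exact: measurable_circle_param.
- apply/trivIsetP => /= i j _ _ ij; rewrite -preimage_setI.
  by move/trivIsetP : tF => /(_ _ _ _ _ ij) ->//; rewrite preimage_set0.
- rewrite -preimage_bigcup -[X in measurable X]setTI.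
  exact: measurable_circle_param.
Qed.

HB.instance Definition _ := isMeasure.Build _ _ _ circle_measure
  circle_measure0 circle_measure_ge0 circle_measure_sigma_additive.

Lemma circle_measureT : circle_measure setT = 1%E.
Proof.
rewrite /circle_measure /pushforward preimage_setT /mrestr setTI.
by rewrite lebesgue_measure_itv /= lte01 oppr0 adde0.
Qed.

HB.instance Definition _ :=
  Measure_isProbability.Build _ _ _ circle_measure circle_measureT.
End circle.

Arguments circle_measure R : clear implicits.

Section hardy.
Variable R : realType.
Local Notation C := R[i].
Local Notation T := (circle R).
Local Notation m := (circle_measure R).
Local Notation normc := ComplexField.Normc.normc.
Implicit Types (f g h u phi : T -> C) (D E : set (T -> C)).

(* Elements of L^2 are represented by (Borel) measurable functions T -> C;
   equality in L^2 is the library's equality f = g %[ae m]. *)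
Definition measurableC f :=
  measurable_fun setT (fun z => complex.Re (f z)) /\
  measurable_fun setT (fun z => complex.Im (f z)).

Definition L2 : set (T -> C) :=
  [set f | measurableC f /\ (\int[m]_z (normc (f z) ^+ 2)%:E < +oo)%E].

Definition integralC f : C :=
  ((\int[m]_z complex.Re (f z)) +i* (\int[m]_z complex.Im (f z)))%C.

Definition dotC f g : C := integralC (fun z => f z * (g z)^*).

Definition normL2 f : R := Num.sqrt (\int[m]_z (normc (f z) ^+ 2)).

Definition fourier f (n : int) : C :=
  integralC (fun z => f z * circle_val z ^ (- n)).

Definition H2 : set (T -> C) :=
  [set f | L2 f /\ forall n : int, n < 0 -> fourier f n = 0].

Definition inner u := H2 u /\ \forall z \ae m, `|u z| = 1.

Definition nonconstant u := ~ exists c : C, u = (fun=> c) %[ae m].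

(* The value at the origin of the analytic extension
   sum_n (fourier u n) lambda^n of u in H^2 to the open disc. *)
Definition at0 u : C := fourier u 0.

(* theta / alpha, that is conj(alpha) theta, since |alpha| = 1 a.e. *)
Definition inner_quot (theta alpha : T -> C) : T -> C :=
  fun z => (alpha z)^* * theta z.

Definition inner_divides (alpha theta : T -> C) :=
  inner (inner_quot theta alpha).

(* K^2_u, the orthogonal complement of u H^2 in H^2. *)
Definition K2 u : set (T -> C) :=
  [set f | H2 f /\ forall h, H2 h -> dotC f (fun z => u z * h z) = 0].

(* The orthogonal projection of f onto D, characterized up to a.e. equality by
   p \in D and f - p _|_ D; the default value 0 is irrelevant when D is a
   closed subspace of L^2 and f \in L^2. *)
Definition ortho_proj D f : T -> C :=
  xget (fun=> 0) [set p | D p /\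
    forall g, D g -> dotC (fun z => f z - p z) g = 0].

Definition PK u : (T -> C) -> (T -> C) := ortho_proj (K2 u).

Definition k0 u : T -> C := fun z => 1 - (at0 u)^* * u z.

Definition kt0 u : T -> C := fun z => (circle_val z)^* * (u z - at0 u).

Definition conjK u f : T -> C := fun z => u z * (circle_val z * f z)^*.

Definition SK u f : T -> C := PK u (fun z => circle_val z * f z).

(* Hilbert space adjoint of an operator X : D -> D, evaluated at g. *)
Definition adjoint D (X : (T -> C) -> (T -> C)) g : T -> C :=
  xget (fun=> 0) [set h | D h /\ forall f, D f -> dotC (X f) g = dotC f h].

Definition rank1 (x y : T -> C) f : T -> C := fun z => dotC f y * x z.

(* Bounded linear operators from the subspace D to the subspace E of L^2;
   values outside D are irrelevant. The second clause says that X is well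
   defined on classes of a.e. equal functions. *)
Definition bounded_operator D E (X : (T -> C) -> (T -> C)) :=
  [/\ forall f, D f -> E (X f),
      forall f g, D f -> D g -> f = g %[ae m] -> X f = X g %[ae m],
      forall (a : C) f g, D f -> D g ->
        X (fun z => a * f z + g z) = (fun z => a * X f z + X g z) %[ae m] &
      exists M : R, forall f, D f -> normL2 (X f) <= M * normL2 f].

(* Asymmetric truncated Toeplitz operator A_phi^{theta,alpha}, for phi in L^2,
   on its natural domain. *)
Definition TTO_dom (theta phi : T -> C) : set (T -> C) :=
  [set f | K2 theta f /\ L2 (fun z => phi z * f z)].

Definition TTO (alpha phi f : T -> C) : T -> C := PK alpha (fun z => phi z * f z).

Definition TTO_extension (theta alpha phi : T -> C) (X : (T -> C) -> (T -> C)) :=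
  bounded_operator (K2 theta) (K2 alpha) X /\
  forall f, TTO_dom theta phi f -> X f = TTO alpha phi f %[ae m].

(* A = A_phi^{theta,alpha}: phi is in L^2, A_phi^{theta,alpha} is bounded on its
   domain, and A is its unique bounded extension to K^2_theta. *)
Definition is_TTO (theta alpha phi : T -> C) (A : (T -> C) -> (T -> C)) :=
  [/\ L2 phi,
      bounded_operator (TTO_dom theta phi) (K2 alpha) (TTO alpha phi),
      TTO_extension theta alpha phi A &
      forall B, TTO_extension theta alpha phi B ->
        forall f, K2 theta f -> B f = A f %[ae m]].

End hardy.

(* Main.v *)
(* Let B be the backward shift and write f = C_theta F, g = C_alpha G.  Since
   S_u C_u = C_u B, the hypothesis on A says that the form
   a(F, G) = <A C_theta F, C_alpha G> satisfies
     a(F, G) = conj(F(0)) <mu, C_alpha G> + G(0) <C_theta F, nu> + a(BF, BG).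
   Iterating n times, and using mu _|_ alpha H2 and nu _|_ theta H2 to turn the
   powers of B into powers of z, the sum of the rank-one terms becomes
     <mu conj(C_alpha G), p_n F> + conj <nu conj(C_theta F), p_n G>,
   p_n being the n-th Taylor polynomial, while the remainder a(B^n F, B^n G)
   tends to 0 because ||B^n F|| = ||F - p_n F||.  For bounded F and G this gives
   <A f, g> = int phi f conj(g) with phi = C_alpha nu + conj(C_theta mu), and
   bounded functions are dense in K2.  The rank-two operator is unchanged if
   (mu, nu) is replaced by (mu + conj(c) kt0 alpha, nu - c kt0 theta); for the
   stated c the K2 beta component v of the new nu (nu = nu1 + alpha v) is
   orthogonal to kt0 beta, so that S_beta v = z v and phi is exactly
   psi + conj(chi).

   Projections onto H2 come from the completeness of L2 (partial sums of the
   Fourier series), and H2 _|_ conj(z H2) from the uniqueness of Fourier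
   coefficients. *)

Require Import Defs.
From mathcomp Require Import all_boot all_order all_algebra.
From mathcomp Require Import all_classical all_reals all_analysis complex.
From mathcomp Require Import measurable_realfun zify ring lra.

Set Implicit Arguments.
Unset Strict Implicit.
Unset Printing Implicit Defensive.

Import Order.TTheory GRing.Theory Num.Theory.
Import numFieldNormedType.Exports.
Local Open Scope classical_set_scope.
Local Open Scope ring_scope.
Local Notation normc := ComplexField.Normc.normc.
Local Notation measurableC := Defs.measurableC.

(** The symbol phi is only in L2, so for a general f in L2 the integral of phi f conj(g) makes sense
    only when g is bounded. Hence the formula for <A f, g> is proved for bounded f and g, then for
    all f by continuity of A, and it reaches unbounded g only under the domain condition phi f in
    L2.

    Origin of c: as kt0 theta = beta(0) kt0 alpha + alpha kt0 beta, passing from nu to nu - c kt0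
    theta changes w = P_beta(conj(alpha) nu) into w - c kt0 beta, so c is the coefficient of the
    projection of w on kt0 beta. On K2 beta one has S_beta v = z v - <v, kt0 beta> beta, and
    orthogonality removes the last term. Finally C_alpha(alpha v) = conj(z v) and C_theta mu = beta
    C_alpha mu, which is how phi falls apart into psi and conj(chi).

    Uniqueness of Fourier coefficients is proved by measure theory: the sets whose indicator
    preserves the vanishing of all coefficients form a sigma-algebra, and it contains the
    half-planes cut out by the coordinates. *)

Section ComplexParts.
Variable R : realType.
Implicit Types x y : R[i].

Lemma ReM x y : complex.Re (x * y) =
  complex.Re x * complex.Re y - complex.Im x * complex.Im y.
Proof. by case: x; case: y. Qed.

Lemma ImM x y : complex.Im (x * y) =
  complex.Re x * complex.Im y + complex.Im x * complex.Re y.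
Proof. by case: x; case: y. Qed.

Lemma ReD x y : complex.Re (x + y) = complex.Re x + complex.Re y.
Proof. by case: x; case: y. Qed.

Lemma ImD x y : complex.Im (x + y) = complex.Im x + complex.Im y.
Proof. by case: x; case: y. Qed.

Lemma ReJ x : complex.Re x^* = complex.Re x. Proof. by case: x. Qed.

Lemma ImJ x : complex.Im x^* = - complex.Im x. Proof. by case: x. Qed.

Lemma sqr_normc x : normc x ^+ 2 = complex.Re x ^+ 2 + complex.Im x ^+ 2.
Proof. by case: x => a b; rewrite /normc sqr_sqrtr// addr_ge0// sqr_ge0. Qed.

Lemma normc_ge0 x : 0 <= normc x.
Proof. by case: x => a b; exact: sqrtr_ge0. Qed.

Lemma normr_Re_le x : `|complex.Re x| <= normc x.
Proof.
by rewrite -(@ler_pXn2r _ 2%N) ?nnegrE ?normc_ge0// sqr_normc real_normK ?num_real// lerDl sqr_ge0.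
Qed.

Lemma normr_Im_le x : `|complex.Im x| <= normc x.
Proof.
by rewrite -(@ler_pXn2r _ 2%N) ?nnegrE ?normc_ge0// sqr_normc real_normK ?num_real// lerDr sqr_ge0.
Qed.

Lemma normcE x : `|x| = (normc x)%:C%C.
Proof. by case: x. Qed.

Lemma normc_conj x : normc x^* = normc x.
Proof. by case: x => a b /=; rewrite sqrrN. Qed.

Lemma mulC_conj x : x * x^* = (normc x ^+ 2)%:C%C.
Proof. by rewrite -normCK normcE rmorphXn. Qed.

Lemma sqr_normcD_le x y : normc (x + y) ^+ 2 <= 2 * normc x ^+ 2 + 2 * normc y ^+ 2.
Proof.
rewrite !sqr_normc ReD ImD.
move: (complex.Re x) (complex.Re y) (complex.Im x) (complex.Im y) => a b c d.
rewrite -subr_ge0 [leRHS](_ : _ = (a - b) ^+ 2 + (c - d) ^+ 2); last by ring.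
by rewrite addr_ge0 ?sqr_ge0.
Qed.

Lemma normcD_le x y : normc (x + y) <= normc x + normc y.
Proof. by rewrite -lecR rmorphD /= -!normcE ler_normD. Qed.

Lemma normcM_le x y : normc (x * y) <= normc x ^+ 2 + normc y ^+ 2.
Proof.
rewrite ComplexField.Normc.normcM.
move: (normc x) (normc y) (normc_ge0 x) (normc_ge0 y) => a b a0 b0.
by have := sqr_ge0 (a - b); nra.
Qed.

End ComplexParts.

(** * Integration and L2 on the circle *)

Section L2theory.
Variable R : realType.
Local Notation C := R[i].
Local Notation T := (circle R).
Local Notation m := (circle_measure R).
Implicit Types (f g h u v : T -> C).

(** Phrased through real and imaginary parts because [integralC] is componentwise, so that linearity
    is inherited from the real integral. *)
Definition L1 f :=
  m.-integrable setT (EFin \o (fun z => complex.Re (f z))) /\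
  m.-integrable setT (EFin \o (fun z => complex.Im (f z))).

Lemma L1_measurable f : L1 f -> measurableC f.
Proof.
by case=> /measurable_int/measurable_EFinP ? /measurable_int/measurable_EFinP ?.
Qed.

Lemma measurableC_cst (a : C) : measurableC (fun=> a : C).
Proof. by split; exact: measurable_cst. Qed.

Lemma measurableC_add f g : measurableC f -> measurableC g ->
  measurableC (fun z => f z + g z).
Proof.
move=> [f1 f2] [g1 g2]; split.
  by under eq_fun do rewrite ReD; exact: measurable_funD.
by under eq_fun do rewrite ImD; exact: measurable_funD.
Qed.

Lemma measurableC_mul f g : measurableC f -> measurableC g ->
  measurableC (fun z => f z * g z).
Proof.
move=> [f1 f2] [g1 g2]; split.
  by under eq_fun do rewrite ReM; apply: measurable_funB; exact: measurable_funM.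
by under eq_fun do rewrite ImM; apply: measurable_funD; exact: measurable_funM.
Qed.

Lemma measurableC_conj f : measurableC f -> measurableC (fun z => (f z)^*).
Proof.
move=> [f1 f2]; split.
  by under eq_fun do rewrite ReJ.
by under eq_fun do rewrite ImJ; exact: measurableT_comp.
Qed.

Lemma measurable_circle_coord : measurable_fun setT (@circle_coord R).
Proof. by move=> _ B mB; exists B => //. Qed.

Lemma measurableC_id : measurableC (fun z : T => circle_val z).
Proof.
split; first exact: (measurableT_comp measurable_fst measurable_circle_coord).
exact: (measurableT_comp measurable_snd measurable_circle_coord).
Qed.

Lemma measurable_normc_sq f : measurableC f ->
  measurable_fun setT (fun z => normc (f z) ^+ 2).
Proof.
move=> [f1 f2]; under eq_fun do rewrite sqr_normc.
by apply: measurable_funD; exact: measurable_funX.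
Qed.

Lemma L2P f : L2 f <->
  measurableC f /\ m.-integrable setT (fun z => (normc (f z) ^+ 2)%:E).
Proof.
split=> [[mf fi]|[mf fi]]; split=> //.
  apply/integrableP; split.
    by apply/measurable_EFinP; exact: measurable_normc_sq.
  by under eq_integral do rewrite gee0_abs ?lee_fin ?sqr_ge0//.
case/integrableP : fi => _; under eq_integral do rewrite gee0_abs ?lee_fin ?sqr_ge0//.
by [].
Qed.

Lemma L1_dominated f (g : T -> R) : measurableC f ->
  m.-integrable setT (EFin \o g) -> (forall z, normc (f z) <= g z) -> L1 f.
Proof.
move=> [f1 f2] ig fg; split.
  apply: le_integrable ig => //; first exact/measurable_EFinP.
  move=> z _; rewrite /= lee_fin (le_trans (normr_Re_le _))//.
  by rewrite (le_trans (fg z))// ler_norm.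
apply: le_integrable ig => //; first exact/measurable_EFinP.
move=> z _; rewrite /= lee_fin (le_trans (normr_Im_le _))//.
by rewrite (le_trans (fg z))// ler_norm.
Qed.

Lemma L2M f g : L2 f -> L2 g -> L1 (fun z => f z * g z).
Proof.
move=> /L2P[mf fi] /L2P[mg gi].
apply: (@L1_dominated _ (fun z => normc (f z) ^+ 2 + normc (g z) ^+ 2)).
- exact: measurableC_mul.
- by have := integrableD measurableT fi gi.
- by move=> z; exact: normcM_le.
Qed.

Lemma L2_conj f : L2 f -> L2 (fun z => (f z)^*).
Proof.
move=> /L2P[mf fi]; apply/L2P; split; first exact: measurableC_conj.
by under eq_fun do rewrite normc_conj.
Qed.

Lemma L2D f g : L2 f -> L2 g -> L2 (fun z => f z + g z).
Proof.
move=> /L2P[mf fi] /L2P[mg gi]; apply/L2P; split; first exact: measurableC_add.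
have fi' := integrableZl measurableT 2 fi.
have gi' := integrableZl measurableT 2 gi.
apply: le_integrable (integrableD measurableT fi' gi') => //.
  by apply/measurable_EFinP; apply: measurable_normc_sq; exact: measurableC_add.
move=> z _; rewrite /= lee_fin ger0_norm ?sqr_ge0// ger0_norm; first exact: sqr_normcD_le.
by rewrite addr_ge0// mulr_ge0// sqr_ge0.
Qed.

Definition bounded_ae f := exists M : R, \forall z \ae m, normc (f z) <= M.

Lemma L2_bounded_mul u f : measurableC u -> bounded_ae u -> L2 f ->
  L2 (fun z => u z * f z).
Proof.
move=> mu [M uM] [mf fi]; split; first exact: measurableC_mul.
have mfn : measurable_fun setT (fun z => (normc (f z) ^+ 2)%:E).
  by apply/measurable_EFinP; exact: measurable_normc_sq.
apply: (@le_lt_trans _ _ (\int[m]_z ((M ^+ 2)%:E * (normc (f z) ^+ 2)%:E))%E).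
  apply: ae_ge0_le_integral => //.
  - by move=> z _; rewrite lee_fin sqr_ge0.
  - by apply/measurable_EFinP; apply: measurable_normc_sq; exact: measurableC_mul.
  - by move=> z _; rewrite mule_ge0 ?lee_fin ?sqr_ge0.
  - by apply: emeasurable_funM.
  - apply: filterS uM => z uM _; rewrite lee_fin ComplexField.Normc.normcM exprMn.
    rewrite ler_wpM2r ?sqr_ge0// ler_pXn2r ?nnegrE ?normc_ge0//.
    exact: le_trans (normc_ge0 _) uM.
rewrite ge0_integralZl_EFin ?sqr_ge0//; last by move=> z _; rewrite lee_fin sqr_ge0.
by apply: lte_mul_pinfty => //; rewrite lee_fin sqr_ge0.
Qed.

Lemma bounded_cst (a : C) : bounded_ae (fun=> a).
Proof. by exists (normc a); exact: aeW. Qed.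

Lemma L2Z (a : C) f : L2 f -> L2 (fun z => a * f z).
Proof. by apply: L2_bounded_mul; [exact: measurableC_cst|exact: bounded_cst]. Qed.

Lemma L2_cst (a : C) : L2 (fun=> a : C).
Proof.
split; first exact: measurableC_cst.
by rewrite integral_cst//= -ge0_fin_numE ?mule_ge0 ?lee_fin ?sqr_ge0// circle_measureT mule1.
Qed.

Lemma L2B f g : L2 f -> L2 g -> L2 (fun z => f z - g z).
Proof.
move=> f2 g2; have := L2D f2 (L2Z (- 1) g2).
by under eq_fun do rewrite mulN1r.
Qed.

Lemma L2_L1 f : L2 f -> L1 f.
Proof.
move=> f2; have := L2M f2 (L2_cst 1).
by under eq_fun do rewrite mulr1.
Qed.

Lemma L1D f g : L1 f -> L1 g -> L1 (fun z => f z + g z).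
Proof.
move=> [f1 f2] [g1 g2]; split.
  have := integrableD measurableT f1 g1; apply: eq_integrable => // z _ /=.
  by rewrite ReD.
have := integrableD measurableT f2 g2; apply: eq_integrable => // z _ /=.
by rewrite ImD.
Qed.

Lemma L1Z (a : C) f : L1 f -> L1 (fun z => a * f z).
Proof.
move=> [f1 f2]; split.
  have := integrableB measurableT (integrableZl measurableT (complex.Re a) f1)
    (integrableZl measurableT (complex.Im a) f2).
  by apply: eq_integrable => // z _ /=; rewrite ReM.
have := integrableD measurableT (integrableZl measurableT (complex.Re a) f2)
    (integrableZl measurableT (complex.Im a) f1).
by apply: eq_integrable => // z _ /=; rewrite ImM.
Qed.

Lemma L1_conj f : L1 f -> L1 (fun z => (f z)^*).
Proof.
move=> [f1 f2]; split.
  by move: f1; apply: eq_integrable => // z _ /=; rewrite ReJ.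
have := integrableN f2.
by apply: eq_integrable => // z _ /=; rewrite ImJ.
Qed.

Lemma integralC_ae f g : measurableC f -> measurableC g ->
  f = g %[ae m] -> integralC f = integralC g.
Proof.
move=> [f1 f2] [g1 g2] fg; rewrite /integralC /Rintegral.
congr Complex; congr fine; apply: ae_eq_integral => //; try exact/measurable_EFinP.
  by apply: filterS fg => z /(_ I) ->.
by apply: filterS fg => z /(_ I) ->.
Qed.

Lemma integralCD f g : L1 f -> L1 g ->
  integralC (fun z => f z + g z) = integralC f + integralC g.
Proof.
move=> [f1 f2] [g1 g2]; rewrite /integralC.
under eq_Rintegral do rewrite ReD.
rewrite RintegralD//.
under [in X in Complex _ X]eq_Rintegral do rewrite ImD.
by rewrite RintegralD.
Qed.

Lemma integralCZ (a : C) f : L1 f ->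
  integralC (fun z => a * f z) = a * integralC f.
Proof.
move=> [f1 f2]; rewrite /integralC.
have iZ r (h : T -> R) : m.-integrable setT (EFin \o h) ->
    m.-integrable setT (EFin \o (fun z => r * h z)).
  by move=> hi; have := integrableZl measurableT r hi.
under eq_Rintegral do rewrite ReM.
rewrite RintegralB//; [|exact: iZ|exact: iZ].
under [in X in Complex _ X]eq_Rintegral do rewrite ImM.
rewrite RintegralD//; [|exact: iZ|exact: iZ].
by rewrite !RintegralZl//; case: a.
Qed.

Lemma integralC_conj f : L1 f -> integralC (fun z => (f z)^*) = (integralC f)^*.
Proof.
move=> [f1 f2]; rewrite /integralC.
under eq_Rintegral do rewrite ReJ.
under [in X in Complex _ X]eq_Rintegral do rewrite ImJ -mulN1r.
by rewrite RintegralZl// mulN1r.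
Qed.

Lemma integralC0 : integralC (fun=> 0 : C) = 0.
Proof. by rewrite /integralC/= Rintegral_cst// mul0r. Qed.

Lemma integralC1 : integralC (fun=> 1 : C) = 1.
Proof.
by rewrite /integralC/= !Rintegral_cst//= circle_measureT/= mul0r mulr1.
Qed.
End L2theory.

(** * Inner product and norm of L2 *)

Section Inner.
Variable R : realType.
Local Notation C := R[i].
Local Notation T := (circle R).
Local Notation m := (circle_measure R).
Implicit Types (f g h u v : T -> C).

Lemma L1_dotC f g : L2 f -> L2 g -> L1 (fun z => f z * (g z)^*).
Proof. by move=> f2 g2; exact/L2M/L2_conj. Qed.

Lemma dotC_conj f g : L2 f -> L2 g -> (dotC f g)^* = dotC g f.
Proof.
move=> f2 g2; rewrite /dotC -integralC_conj; last exact: L1_dotC.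
by congr integralC; apply/funext => z; rewrite rmorphM /= conjCK mulrC.
Qed.

Lemma dotCDl f g h : L2 f -> L2 g -> L2 h ->
  dotC (fun z => f z + g z) h = dotC f h + dotC g h.
Proof.
move=> f2 g2 h2; rewrite /dotC -integralCD; [|exact: L1_dotC..].
by congr integralC; apply/funext => z; rewrite mulrDl.
Qed.

Lemma dotCZl (a : C) f h : L2 f -> L2 h ->
  dotC (fun z => a * f z) h = a * dotC f h.
Proof.
move=> f2 h2; rewrite /dotC -integralCZ; last exact: L1_dotC.
by congr integralC; apply/funext => z; rewrite mulrA.
Qed.

Lemma dotCBl f g h : L2 f -> L2 g -> L2 h ->
  dotC (fun z => f z - g z) h = dotC f h - dotC g h.
Proof.
move=> f2 g2 h2; rewrite -[in RHS]mulN1r -dotCZl// -dotCDl//; last exact: L2Z.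
by congr dotC; apply/funext => z; rewrite mulN1r.
Qed.

Lemma dotCDr f g h : L2 f -> L2 g -> L2 h ->
  dotC h (fun z => f z + g z) = dotC h f + dotC h g.
Proof.
move=> f2 g2 h2; rewrite -dotC_conj//; last exact: L2D.
by rewrite dotCDl// rmorphD /= !dotC_conj.
Qed.

Lemma dotCZr (a : C) f h : L2 f -> L2 h ->
  dotC h (fun z => a * f z) = a^* * dotC h f.
Proof.
move=> f2 h2; rewrite -dotC_conj//; last exact: L2Z.
by rewrite dotCZl// rmorphM /= dotC_conj.
Qed.

Lemma dotCBr f g h : L2 f -> L2 g -> L2 h ->
  dotC h (fun z => f z - g z) = dotC h f - dotC h g.
Proof.
move=> f2 g2 h2; rewrite -dotC_conj//; last exact: L2B.
by rewrite dotCBl// rmorphB /= !dotC_conj.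
Qed.

Lemma dotC0l h : dotC (fun=> 0) h = 0.
Proof. by rewrite /dotC; under eq_fun do rewrite mul0r; exact: integralC0. Qed.

Lemma dotC0r h : dotC h (fun=> 0) = 0.
Proof. by rewrite /dotC; under eq_fun do rewrite rmorph0 mulr0; exact: integralC0. Qed.

Lemma dotC_ae f f' g g' : measurableC f -> measurableC f' ->
  measurableC g -> measurableC g' ->
  f = f' %[ae m] -> g = g' %[ae m] -> dotC f g = dotC f' g'.
Proof.
move=> mf mf' mg mg' ff' gg'; apply: integralC_ae.
- exact/measurableC_mul/measurableC_conj.
- exact/measurableC_mul/measurableC_conj.
- by apply: filterS2 ff' gg' => z + + _ => /(_ I) -> /(_ I) ->.
Qed.

Lemma normL2_ge0 f : 0 <= normL2 f. Proof. exact: sqrtr_ge0. Qed.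

Lemma normL2_sq f : normL2 f ^+ 2 = \int[m]_z (normc (f z) ^+ 2).
Proof. by rewrite sqr_sqrtr// Rintegral_ge0// => z _; rewrite sqr_ge0. Qed.

Lemma dotCff f : L2 f -> dotC f f = (normL2 f ^+ 2)%:C%C.
Proof.
move=> f2; rewrite normL2_sq /dotC /integralC.
congr Complex; first by apply: eq_Rintegral => z _; rewrite mulC_conj.
under eq_Rintegral do rewrite mulC_conj /=.
by rewrite Rintegral_cst// mul0r.
Qed.

Lemma normL2_ae f f' : measurableC f -> measurableC f' ->
  f = f' %[ae m] -> normL2 f = normL2 f'.
Proof.
move=> mf mf' ff'; congr Num.sqrt; congr fine; apply: ae_eq_integral => //.
- exact/measurable_EFinP/measurable_normc_sq.
- exact/measurable_EFinP/measurable_normc_sq.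
- by apply: filterS ff' => z /[apply] ->.
Qed.

Lemma normL2_integral f : L2 f ->
  (\int[m]_z (normc (f z) ^+ 2)%:E)%E = (normL2 f ^+ 2)%:E.
Proof.
move=> [mf fi]; rewrite normL2_sq fineK// ge0_fin_numE//.
by apply: integral_ge0 => z _; rewrite lee_fin sqr_ge0.
Qed.

Lemma normL2_le f (M : R) : 0 <= M ->
  (\int[m]_z (normc (f z) ^+ 2)%:E <= (M ^+ 2)%:E)%E -> normL2 f <= M.
Proof.
move=> M0 fM; rewrite -(@ler_pXn2r _ 2%N) ?nnegrE ?normL2_ge0// normL2_sq.
rewrite -lee_fin fineK// ge0_fin_numE; first exact: le_lt_trans fM (ltry _).
by apply: integral_ge0 => z _; rewrite lee_fin sqr_ge0.
Qed.

Lemma normL2_eq0 f : L2 f -> normL2 f = 0 -> f = (fun=> 0) %[ae m].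
Proof.
move=> f2 f0; have := normL2_integral f2; rewrite f0 expr0n /= => fi.
have mf : measurable_fun setT (fun z => (normc (f z) ^+ 2)%:E).
  by apply/measurable_EFinP; apply: measurable_normc_sq; case: f2.
have /(ae_eq_integral_abs _ measurableT mf) : (\int[m]_z `|(normc (f z) ^+ 2)%:E| = 0)%E.
  by rewrite -[RHS]fi; apply: eq_integral => z _; rewrite gee0_abs ?lee_fin ?sqr_ge0.
apply: filterS => z /(_ I) [] /eqP; rewrite sqrf_eq0 => /eqP fz _.
exact: ComplexField.Normc.eq0_normc.
Qed.

Lemma dotC_eq0 f : L2 f -> dotC f f = 0 -> f = (fun=> 0) %[ae m].
Proof.
move=> f2; rewrite dotCff// => -[] /eqP; rewrite sqrf_eq0 => /eqP.
exact: normL2_eq0.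
Qed.

Lemma CauchySchwarz f g : L2 f -> L2 g -> normc (dotC f g) <= normL2 f * normL2 g.
Proof.
move=> f2 g2.
rewrite -(@ler_pXn2r _ 2%N) ?nnegrE ?mulr_ge0 ?normL2_ge0 ?normc_ge0// exprMn.
have [g0|gn0] := eqVneq (normL2 g) 0.
  have -> : dotC f g = 0.
    have [[mf _] [mg _]] := (f2, g2).
    rewrite -(dotC0r f); apply: dotC_ae => //; first exact: ae_eq_refl.
    exact: normL2_eq0.
  by rewrite ComplexField.Normc.normc0 expr0n mulr_ge0 ?sqr_ge0.
have gp : 0 < normL2 g ^+ 2 by rewrite exprn_gt0// lt_def gn0 normL2_ge0.
(* The squared norm of a f - b g is a (a ||f||^2 - |b|^2); it is nonnegative, and dividing by a > 0
   gives the claim. *)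
pose a : C := (normL2 g ^+ 2)%:C%C; pose b := dotC f g.
have aJ : a^* = a by exact: conjc_real.
have h2 : L2 (fun z => a * f z - b * g z) by apply: L2B; exact: L2Z.
have : dotC (fun z => a * f z - b * g z) (fun z => a * f z - b * g z) =
    a * (a * (normL2 f ^+ 2)%:C%C - (normc b ^+ 2)%:C%C).
  rewrite dotCBl//; [|exact: L2Z..].
  rewrite !dotCZl// !dotCBr//; [|exact: L2Z..].
  rewrite !dotCZr// !dotCff// -(dotC_conj f2 g2) -/a -/b aJ -mulC_conj.
  ring.
rewrite dotCff// => H; have {H} : 0 <= a * (a * (normL2 f ^+ 2)%:C%C - (normc b ^+ 2)%:C%C).
  by rewrite -H ler0c sqr_ge0.
rewrite /a -!rmorphM -rmorphB -rmorphM ler0c pmulr_rge0// subr_ge0.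
by rewrite mulrC.
Qed.

Lemma normL2D f g : L2 f -> L2 g ->
  normL2 (fun z => f z + g z) <= normL2 f + normL2 g.
Proof.
move=> f2 g2.
rewrite -(@ler_pXn2r _ 2%N) ?nnegrE ?addr_ge0 ?normL2_ge0//.
have fg2 := L2D f2 g2.
have := dotCff fg2; rewrite dotCDl// !dotCDr// !dotCff// -(dotC_conj f2 g2).
move: (dotC f g) (CauchySchwarz f2 g2) => d dle.
move/(congr1 (@complex.Re R)); rewrite !ReD ReJ /= => <-.
have := le_trans (normr_Re_le _) dle.
by rewrite ler_norml => /andP[_ xle]; rewrite sqrrD mulr2n; lra.
Qed.

Lemma normL2Z (a : C) f : L2 f -> normL2 (fun z => a * f z) = normc a * normL2 f.
Proof.
move=> f2; apply/eqP; rewrite -(@eqrXn2 _ 2%N) ?mulr_ge0 ?normL2_ge0 ?normc_ge0//.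
have af2 := L2Z a f2.
have := dotCff af2; rewrite dotCZl// dotCZr// dotCff// mulrA mulC_conj -rmorphM.
by move=> [<-]; rewrite exprMn.
Qed.

Lemma normL2N f : L2 f -> normL2 (fun z => - f z) = normL2 f.
Proof.
move=> f2; under eq_fun do rewrite -mulN1r.
rewrite normL2Z//; have /= := normcE (-1 : C).
by rewrite normrN1 => -[<-]; rewrite mul1r.
Qed.

Lemma normL2B f g : L2 f -> L2 g ->
  normL2 (fun z => f z - g z) <= normL2 f + normL2 g.
Proof.
move=> f2 g2; rewrite -(normL2N g2); apply: normL2D => //.
by have := L2Z (-1) g2; under eq_fun do rewrite mulN1r.
Qed.

Lemma normL2_sym f g : L2 f -> L2 g ->
  normL2 (fun z => f z - g z) = normL2 (fun z => g z - f z).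
Proof.
move=> f2 g2; rewrite -normL2N; last exact: L2B.
by under eq_fun do rewrite opprB.
Qed.

Lemma normL2_unimodular_mul u f : measurableC u -> (\forall z \ae m, `|u z| = 1) ->
  L2 f -> normL2 (fun z => u z * f z) = normL2 f.
Proof.
move=> mu u1 f2; congr Num.sqrt; congr fine.
have [mf _] := f2.
apply: ae_eq_integral => //.
- by apply/measurable_EFinP; apply: measurable_normc_sq; exact: measurableC_mul.
- exact/measurable_EFinP/measurable_normc_sq.
- apply: filterS u1 => z; rewrite normcE => -[uz] _.
  by rewrite ComplexField.Normc.normcM uz mul1r.
Qed.

End Inner.

(** * Completeness of L2 *)

Section Completeness.
Variable R : realType.
Local Notation C := R[i].
Local Notation T := (circle R).
Local Notation m := (circle_measure R).
Implicit Types (f g h u v : T -> C).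

(** The telescoping series of the increments converges absolutely. *)
Lemma cvgn_of_bounded_variation (u : R^nat) (B : R) :
  (forall n, \sum_(0 <= k < n) `|u k.+1 - u k| <= B) -> cvgn u.
Proof.
move=> uB; pose d k := u k.+1 - u k.
have : cvgn (series d).
  apply: normed_cvg; apply: nondecreasing_is_cvgn.
    by apply/nondecreasing_seqP => n; rewrite /= !/(series _ _) /= big_nat_recr//= lerDl.
  by exists B => _ [n _ <-]; exact: uB.
move=> dc; have -> : u = (fun n => u 0 + series d n).
  by apply/funext => n; rewrite /series/= telescope_sumr// addrC subrK.
by apply: is_cvgD => //; exact: is_cvg_cst.
Qed.

Lemma measurable_normc f : measurableC f -> measurable_fun setT (fun z => normc (f z)).
Proof.
move=> mf; have -> : (fun z => normc (f z)) = (fun z => Num.sqrt (normc (f z) ^+ 2)).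
  by apply/funext => z; rewrite sqrtr_sqr ger0_norm ?normc_ge0.
apply: measurableT_comp (measurable_normc_sq mf).
by apply: continuous_measurable_fun; exact: sqrt_continuous.
Qed.

Lemma cvgn_EFin (u : R^nat) (l : R) :
  u n @[n --> \oo] --> l -> (u n)%:E @[n --> \oo] --> l%:E.
Proof. by move=> ul; apply: cvg_EFin => //; exact: nearW. Qed.

Lemma limn_einf_le (u : (\bar R)^nat) (M : \bar R) N :
  (forall n, (N <= n)%N -> (u n <= M)%E) -> (limn_einf u <= M)%E.
Proof.
move=> uM; rewrite limn_einf_lim; apply: lime_le; first exact: is_cvg_einfs.
exists N => // n /= Nn; apply: le_trans (uM _ Nn).
by apply: ereal_inf_lbound; exists n => /=.
Qed.

(** Cauchy-Schwarz against the constant 1 on a probability space, obtained by integrating x <= e/2 +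
    x^2/(2e). *)
Lemma integral_normc_le f (e : R) : 0 < e -> L2 f -> normL2 f <= e ->
  (\int[m]_z (normc (f z))%:E <= e%:E)%E.
Proof.
move=> e0 f2 fe.
have [mf _] := f2.
have mn : measurable_fun setT (fun z => (normc (f z) ^+ 2)%:E).
  exact/measurable_EFinP/measurable_normc_sq.
have mn1 : measurable_fun setT (fun z => normc (f z)).
  exact: measurable_normc.
apply: (@le_trans _ _ (\int[m]_z ((e / 2)%:E + ((2 * e)^-1)%:E * (normc (f z) ^+ 2)%:E))%E).
  apply: ge0_le_integral => //.
  - by move=> z _; rewrite lee_fin normc_ge0.
  - exact/measurable_EFinP.
  - by apply: emeasurable_funD => //; apply: emeasurable_funM.
  move=> z _; rewrite -EFinM -EFinD lee_fin.
  move: (normc (f z)) => x; rewrite -subr_ge0.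
  rewrite [leRHS](_ : _ = (2 * e)^-1 * (x - e) ^+ 2); last by field; rewrite gt_eqF.
  by rewrite mulr_ge0 ?sqr_ge0// invr_ge0 mulr_ge0// ltW.
have ei0 : 0 <= (2 * e)^-1 by rewrite invr_ge0 mulr_ge0// ltW.
rewrite ge0_integralD//; last 3 first.
- by move=> z _; rewrite lee_fin divr_ge0// ltW.
- by move=> z _; rewrite mule_ge0// lee_fin// sqr_ge0.
- by apply: emeasurable_funM.
rewrite integral_cst//= ge0_integralZl_EFin//; last by move=> z _; rewrite lee_fin sqr_ge0.
rewrite normL2_integral// circle_measureT mule1 -EFinM -EFinD lee_fin.
rewrite [leRHS](_ : e = e / 2 + (2 * e)^-1 * e ^+ 2); last by field; rewrite gt_eqF.
by rewrite lerD2l ler_wpM2l// ler_pXn2r ?nnegrE ?normL2_ge0// ltW.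
Qed.

(** The increments have summable L1 norms, so the sum of their moduli is finite almost everywhere;
    at such points the real and imaginary parts have bounded variation. *)
Lemma L2_fast_cauchy_complete (f : nat -> T -> C) :
  (forall n, L2 (f n)) ->
  (forall n, normL2 (fun z => f n.+1 z - f n z) <= 2^-1 ^+ n) ->
  exists2 g, measurableC g &
    \forall z \ae m, (complex.Re (f n z) @[n --> \oo] --> complex.Re (g z)) /\
                     (complex.Im (f n z) @[n --> \oo] --> complex.Im (g z)).
Proof.
move=> f2 fd.
(* An upper limit is measurable everywhere, including at the points of divergence, and equals the
   limit where there is one. *)
pose lim (F : C -> R) z := fine (limn_esup (fun n => (F (f n z))%:E)).
have mlim F : (forall n, measurable_fun setT (F \o f n)) -> measurable_fun setT (lim F).
  move=> mF; apply: (@measurableT_comp _ _ _ _ _ _ fine _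
    (fun z => limn_esup (fun n => (F (f n z))%:E))) => //.
  apply: (measurable_fun_limn_esup (f := fun n z => (F (f n z))%:E)) => n.
  exact/measurable_EFinP/mF.
exists (fun z => Complex (lim (@complex.Re R) z) (lim (@complex.Im R) z)).
  by split; apply: mlim => n; have [[]] := f2 n.
have d2 n : L2 (fun z => f n.+1 z - f n z) by exact: L2B.
have mn n : measurable_fun setT (fun z => (normc (f n.+1 z - f n z))%:E).
  by apply/measurable_EFinP/measurable_normc; case: (d2 n).
have nn z : (0 <= \sum_(0 <= n <oo) (normc (f n.+1 z - f n z))%:E)%E.
  by apply: nneseries_ge0 => n _ _; rewrite lee_fin normc_ge0.
have : m.-integrable setT (fun z => \sum_(0 <= n <oo) (normc (f n.+1 z - f n z))%:E)%E.
  apply/integrableP; split.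
    by apply: ge0_emeasurable_sum => // n z _ _; rewrite lee_fin normc_ge0.
  under eq_integral do rewrite gee0_abs//.
  rewrite integral_nneseries//; last by move=> n z _; rewrite lee_fin normc_ge0.
  apply: (@le_lt_trans _ _ (\sum_(0 <= n <oo) (2^-1 ^+ n)%:E)%E).
    apply: lee_nneseries => [n _ _|n _].
      by apply: integral_ge0 => z _; rewrite lee_fin normc_ge0.
    by apply: integral_normc_le => //; rewrite exprn_gt0// invr_gt0.
  have h1 : `|2^-1 : R| < 1 by rewrite ger0_norm ?invr_ge0// invf_lt1// ltr1n.
  have /cvg_lim -> : (\sum_(0 <= k < n) (2^-1 ^+ k)%:E)%E @[n --> \oo] -->
      ((1 * (1 - 2^-1)^-1) : R)%:E.
    have := @cvg_geometric_series _ 1 _ h1 => /cvgn_EFin.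
    apply: cvg_trans; apply: near_eq_cvg; apply: nearW => n.
    rewrite /= /series/= sumEFin; congr EFin; apply: eq_bigr => k _.
    by rewrite /geometric /= mul1r.
  - exact: ltry.
  - exact: ereal_hausdorff.
move/(integrable_ae measurableT); apply: filterS => z /(_ I) zfin.
have key (F : C -> R) : (forall x y, `|F x - F y| <= normc (x - y)) ->
    F (f n z) @[n --> \oo] --> lim F z.
  move=> Fle; have : cvgn (fun n => F (f n z)).
    apply: (@cvgn_of_bounded_variation _
      (fine (\sum_(0 <= n <oo) (normc (f n.+1 z - f n z))%:E)%E)) => n.
    apply: (@le_trans _ _ (\sum_(0 <= k < n) normc (f k.+1 z - f k z))).
      by apply: ler_sum => k _; exact: Fle.
    rewrite -lee_fin fineK// -sumEFin; apply: nneseries_lim_ge => k _ _.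
    by rewrite lee_fin normc_ge0.
  move=> cF; suff -> : lim F z = limn (fun n => F (f n z)) by [].
  have cFE : (F (f n z))%:E @[n --> \oo] --> (limn (fun n => F (f n z)))%:E.
    exact: cvgn_EFin.
  by rewrite /lim is_cvg_limn_esupE ?(cvg_lim _ cFE)//; apply/cvg_ex; eexists; exact: cFE.
split; apply: key => x y.
  by have := normr_Re_le (x - y); case: x; case: y.
by have := normr_Im_le (x - y); case: x; case: y.
Unshelve. all: by end_near. Qed.

(** A fast subsequence converges almost everywhere, and Fatou's lemma turns pointwise convergence
    into convergence in norm. *)
Theorem L2_complete (f : nat -> T -> C) :
  (forall n, L2 (f n)) ->
  (forall e : R, 0 < e -> exists N, forall n k, (N <= n)%N -> (N <= k)%N ->
     normL2 (fun z => f n z - f k z) <= e) ->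
  exists2 g, L2 g & forall e : R, 0 < e -> exists N, forall n, (N <= n)%N ->
     normL2 (fun z => f n z - g z) <= e.
Proof.
move=> f2 cf.
have /choice [N0 N0P] : forall j, exists N, forall n k, (N <= n)%N -> (N <= k)%N ->
     normL2 (fun z => f n z - f k z) <= 2^-1 ^+ j.
  by move=> j; apply: cf; rewrite exprn_gt0// invr_gt0.
(* The sum makes [N] monotone and at least [N0]; the summand j makes it tend to infinity. *)
pose N j := (\sum_(0 <= i < j.+1) N0 i + j)%N.
have NS j : (N j <= N j.+1)%N.
  by rewrite /N [in leqRHS]big_nat_recr//= leq_add// leq_addr.
have NN0 j : (N0 j <= N j)%N.
  by rewrite /N big_nat_recr//= -addnA addnCA leq_addr.
have Nj j : (j <= N j)%N by exact: leq_addl.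
have [g mg gP] : exists2 g, measurableC g &
    \forall z \ae m, (complex.Re (f (N n) z) @[n --> \oo] --> complex.Re (g z)) /\
                     (complex.Im (f (N n) z) @[n --> \oo] --> complex.Im (g z)).
  apply: (@L2_fast_cauchy_complete (fun n => f (N n))) => // n.
  by apply: N0P; rewrite ?(leq_trans (NN0 n)).
(* Fatou along the subsequence. The integral is kept extended because g is not yet known to be in
   L2. *)
have key n0 (e : R) : 0 < e -> (forall k, (n0 <= k)%N -> normL2 (fun z => f k z - f n0 z) <= e) ->
   (\int[m]_z (normc (g z - f n0 z) ^+ 2)%:E <= (e ^+ 2)%:E)%E.
  move=> e0 ke.
  have dm k : measurable_fun setT (fun z => (normc (f (N k) z - f n0 z) ^+ 2)%:E).
    by apply/measurable_EFinP; apply: measurable_normc_sq; case: (L2B (f2 (N k)) (f2 n0)).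
  have gm : measurable_fun setT (fun z => (normc (g z - f n0 z) ^+ 2)%:E).
    apply/measurable_EFinP; apply: measurable_normc_sq.
    apply: measurableC_add => //.
    by have [+ _] := L2Z (-1) (f2 n0); under eq_fun do rewrite mulN1r.
  have lm : measurable_fun setT
      (fun z => limn_einf (fun k => (normc (f (N k) z - f n0 z) ^+ 2)%:E)).
    under eq_fun do rewrite -[limn_einf _]oppeK -limn_esupN.
    apply: measurableT_comp => //.
    apply: (measurable_fun_limn_esup
      (f := fun k z => (- (normc (f (N k) z - f n0 z) ^+ 2)%:E)%E)) => k.
    exact: measurableT_comp.
  rewrite (@ae_eq_integral _ _ _ _ _
      (fun z => limn_einf (fun k => (normc (f (N k) z - f n0 z) ^+ 2)%:E)))//; last first.
    apply: filterS gP => z [zr zi] _.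
    have : (normc (f (N k) z - f n0 z) ^+ 2)%:E @[k --> \oo] --> (normc (g z - f n0 z) ^+ 2)%:E.
      apply: cvgn_EFin.
      under eq_fun do rewrite /= sqr_normc.
      rewrite sqr_normc.
      have sq (F : R^nat) (l : R) : F @ \oo --> l -> F n ^+ 2 @[n --> \oo] --> l ^+ 2.
        by move=> Fl; rewrite expr2; under eq_fun do rewrite expr2; exact: cvgM.
      apply: cvgD; apply: sq.
        under eq_fun do rewrite ReD; rewrite ReD.
        by apply: cvgD => //; exact: cvg_cst.
      under eq_fun do rewrite ImD; rewrite ImD.
      by apply: cvgD => //; exact: cvg_cst.
    move=> H; rewrite is_cvg_limn_einfE; last by apply/cvg_ex; eexists; exact: H.
    by rewrite (cvg_lim _ H).
  apply: le_trans (fatou m measurableT dm _) _.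
    by move=> k z _; rewrite lee_fin sqr_ge0.
  apply: (@limn_einf_le _ _ n0) => k n0k.
  rewrite normL2_integral; last exact: L2B.
  rewrite lee_fin ler_pXn2r ?nnegrE ?normL2_ge0 ?(ltW e0)//.
  by apply: ke; rewrite (leq_trans n0k).
exists g.
  have [M MP] := cf 1 ltr01.
  have gf : L2 (fun z => g z - f M z).
    split.
      apply: measurableC_add => //.
      by have [+ _] := L2Z (-1) (f2 M); under eq_fun do rewrite mulN1r.
    apply: le_lt_trans (ltry (1 ^+ 2)); apply: key => // k Mk.
    exact: MP.
  have := L2D gf (f2 M).
  by under eq_fun do rewrite subrK.
move=> e e0; have [M MP] := cf e e0; exists M => n Mn.
rewrite (_ : normL2 _ = normL2 (fun z => g z - f n z)); last first.
  congr Num.sqrt; apply: eq_Rintegral => z _; rewrite !sqr_normc.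
  by case: (g z) (f n z) => a b [c d] /=; ring.
apply: normL2_le; first exact: ltW.
apply: key => // k nk; apply: MP => //; exact: leq_trans nk.
Unshelve. all: by end_near. Qed.

End Completeness.

(** * Fourier coefficients and their uniqueness *)

Section Trigonometric.
Variable R : realType.
Local Notation C := R[i].
Local Notation T := (circle R).
Local Notation m := (circle_measure R).
Local Notation mu := (@lebesgue_measure R).

Lemma normr_circle (z : T) : `|circle_val z| = 1 :> C.
Proof. by case: z => z /= /eqP. Qed.

Lemma normc_circle (z : T) : normc (circle_val z) = 1 :> R.
Proof. by have := normr_circle z; rewrite normcE => -[]. Qed.

Lemma circle_neq0 (z : T) : circle_val z != 0 :> C.
Proof. by rewrite -normr_eq0 normr_circle oner_eq0. Qed.

Lemma circle_conj (z : T) : (circle_val z)^* = (circle_val z)^-1 :> C.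
Proof.
apply: (mulfI (circle_neq0 z)); rewrite mulfV ?circle_neq0//.
by rewrite mulC_conj normc_circle expr1n.
Qed.

Lemma circle_mul_conj (z : T) : circle_val z * (circle_val z)^* = 1 :> C.
Proof. by rewrite circle_conj mulfV// circle_neq0. Qed.

Lemma circle_param_exp (t : R) n : circle_val (circle_param t) ^+ n =
  (cos (2 * pi * n%:R * t) +i* sin (2 * pi * n%:R * t))%C.
Proof.
elim: n => [|n IHn].
  by rewrite expr0 mulr0 mul0r cos0 sin0.
have -> : 2 * pi * n.+1%:R * t = 2 * pi * t + 2 * pi * n%:R * t.
  by rewrite -natr1; ring.
rewrite exprS IHn cosD sinD.
have -> : circle_val (circle_param t) = (cos (2 * pi * t) +i* sin (2 * pi * t))%C by [].
move: (cos _) (sin _) (cos _) (sin _) => a b c d.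
by apply/eqP; rewrite eq_complex ReM ImM /=; apply/andP; split; apply/eqP; ring.
Qed.

(** The bound M supplies the integrability needed to integrate against an image measure; the
    complement of [0, 1] is then dropped as null for the restricted measure. *)
Lemma circle_integral (f : T -> R) (M : R) : measurable_fun setT f ->
  (forall z, `|f z| <= M) ->
  (\int[m]_z (f z)%:E = \int[mu]_(t in `[0%R, 1%R]) (f (circle_param t))%:E)%E.
Proof.
move=> mf fM.
pose r := mrestr mu (measurable_itv `[(0:R), 1]).
have mfe : measurable_fun setT (EFin \o f) by exact/measurable_EFinP.
have mfp : measurable_fun setT (EFin \o f \o @circle_param R).
  by apply: measurableT_comp => //; exact: measurable_circle_param.
have rT : r setT = 1%E.
  by rewrite /r /mrestr setTI lebesgue_measure_itv /= lte01 oppr0 adde0.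
have fi : r.-integrable (@circle_param R @^-1` setT) (EFin \o f \o @circle_param R).
  apply/integrableP; split; first by rewrite preimage_setT.
  apply: (@le_lt_trans _ _ (\int[r]_(x in setT) (M%:E))%E).
    rewrite preimage_setT; apply: ge0_le_integral => //.
    - by apply: measurableT_comp.
    - by move=> x _; rewrite lee_fin.
  by rewrite integral_cst//; rewrite [X in (_ * X)%E]rT mule1 ltry.
have -> : (\int[m]_z (f z)%:E = \int[pushforward r (@circle_param R)]_z (EFin \o f) z)%E.
  apply: eq_measure_integral => //.
  by move=> mA A mB; exact: measurable_circle_param.
rewrite integral_pushforward//; last exact: measurable_circle_param.
rewrite preimage_setT.
have D01 : measurable (~` (`[0, 1] : set R)) by rewrite -setTD; exact: measurableD.
rewrite (@negligible_integral _ _ _ r setT (~` `[0, 1]))//; last first.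
  by rewrite /r /= /mrestr setICl measure0.
rewrite setTD setCK.
apply: eq_measure_integral => // A mA A01.
rewrite -[in RHS](setIidl A01); exact: erefl.
Qed.

Lemma itv01_cos (a : R) : a != 0 -> sin a = 0 ->
  (\int[mu]_(t in `[0%R, 1%R]) (cos (a * t))%:E = 0)%E.
Proof.
move=> a0 sa.
have dF (t : R) : is_derive t 1 (fun t => a^-1 * sin (a * t)) (cos (a * t)).
  apply: is_derive_eq; rewrite /GRing.scale /=.
  by field.
have cF t : {for t, continuous (fun t : R => a^-1 * sin (a * t))}.
  apply: differentiable_continuous; apply/derivable1_diffP.
  exact: (@ex_derive _ _ _ _ _ _ _ (dF t)).
rewrite (@continuous_FTC2 _ _ (fun t => a^-1 * sin (a * t)))//.
- by rewrite mulr1 mulr0 sin0 sa mulr0 subee.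
- apply: continuous_subspaceT => t; apply: continuous_comp; last exact: continuous_cos.
  by apply: cvgM => //; exact: cvg_cst.
- split.
  + by move=> t _; apply: (@ex_derive _ _ _ _ _ _ _ (dF t)).
  + apply: cvg_at_right_filter; exact: (cF 0).
  + apply: cvg_at_left_filter; exact: (cF 1).
- by move=> t _; rewrite derive1E; exact: derive_val.
Qed.

Lemma itv01_sin (a : R) : a != 0 -> cos a = 1 ->
  (\int[mu]_(t in `[0%R, 1%R]) (sin (a * t))%:E = 0)%E.
Proof.
move=> a0 ca.
have dF (t : R) : is_derive t 1 (fun t => - (a^-1 * cos (a * t))) (sin (a * t)).
  apply: is_derive_eq; rewrite /GRing.scale /=.
  by field.
have cF t : {for t, continuous (fun t : R => - (a^-1 * cos (a * t)))}.
  apply: differentiable_continuous; apply/derivable1_diffP.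
  exact: (@ex_derive _ _ _ _ _ _ _ (dF t)).
rewrite (@continuous_FTC2 _ _ (fun t => - (a^-1 * cos (a * t))))//.
- by rewrite mulr1 mulr0 cos0 ca subee.
- apply: continuous_subspaceT => t; apply: continuous_comp; last exact: continuous_sin.
  by apply: cvgM => //; exact: cvg_cst.
- split.
  + by move=> t _; apply: (@ex_derive _ _ _ _ _ _ _ (dF t)).
  + apply: cvg_at_right_filter; exact: (cF 0).
  + apply: cvg_at_left_filter; exact: (cF 1).
- by move=> t _; rewrite derive1E; exact: derive_val.
Qed.

Lemma measurableC_exprn n : measurableC (fun z : T => circle_val z ^+ n).
Proof.
elim: n => [|n IHn]; first exact: measurableC_cst.
by under eq_fun do rewrite exprS; apply: measurableC_mul => //; exact: measurableC_id.
Qed.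

Lemma cos_sin_2pin (n : nat) : cos (2 * pi * n%:R) = 1 :> R /\ sin (2 * pi * n%:R) = 0 :> R.
Proof.
elim: n => [|n [IHc IHs]]; first by rewrite mulr0 cos0 sin0.
have -> : 2 * pi * n.+1%:R = 2 * pi * n%:R + 2 * pi :> R by rewrite -natr1; ring.
rewrite cosD sinD IHc IHs.
have -> : 2 * pi = pi *+ 2 :> R by rewrite mulr_natl.
by rewrite cos2pi sin2pi; split; ring.
Qed.

Lemma integralC_exprn n : (0 < n)%N -> integralC (fun z : T => circle_val z ^+ n) = 0.
Proof.
move=> n0; have [mR mI] := measurableC_exprn n.
have n1 (z : T) : normc (circle_val z ^+ n) = 1.
  elim: (n) => [|k IHk]; first by rewrite expr0 ComplexField.Normc.normc1.
  by rewrite exprS ComplexField.Normc.normcM normc_circle mul1r.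
have a0 : 2 * pi * n%:R != 0 :> R.
  by rewrite !mulf_neq0 ?pnatr_eq0 ?gt_eqF ?pi_gt0 -?lt0n.
have [ca sa] := cos_sin_2pin n.
rewrite /integralC /Rintegral.
rewrite (@circle_integral _ 1)//; last by move=> z; rewrite -(n1 z); exact: normr_Re_le.
rewrite (@circle_integral _ 1)//; last by move=> z; rewrite -(n1 z); exact: normr_Im_le.
under eq_integral do rewrite circle_param_exp /=.
rewrite itv01_cos//.
under eq_integral do rewrite circle_param_exp /=.
by rewrite itv01_sin.
Qed.

End Trigonometric.

(** * Polynomial approximation of the sign function *)

Section SignApproximation.
Variable R : realType.

(** The Newton-Schulz iteration for the sign: an odd cubic fixing -1, 0 and 1, with zero derivative
    at -1 and 1. Its iterates are polynomials in s, so they stay inside any algebra containing s and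
    the constants. *)
Definition sign_step (s : R) := (3 * s - s ^+ 3) / 2.

Lemma sign_stepN s : sign_step (- s) = - sign_step s.
Proof. by rewrite /sign_step; field. Qed.

Lemma iter_sign_step0 n : iter n sign_step 0 = 0.
Proof. by elim: n => //= n ->; rewrite /sign_step mulr0 expr0n subrr mul0r. Qed.

(** One step multiplies the distance 1 - t by 1 - (t + t^2)/2, which is at most 1 - s/2 because the
    iterates t never drop below s. *)
Lemma iter_sign_step_bounds (s : R) n : 0 < s <= 1 ->
  s <= iter n sign_step s <= 1 /\ 1 - iter n sign_step s <= (1 - s / 2) ^+ n.
Proof.
move=> /andP[s0 s1]; elim: n => [|n [/andP[]]]; first by rewrite /= lexx s1 expr0; split => //; lra.
rewrite iterS; set t := iter n _ s => st t1 tn.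
have t0 : 0 < t by exact: lt_le_trans st.
have e : 1 - sign_step t = (1 - t) * (1 - (t + t ^+ 2) / 2) by rewrite /sign_step; field.
have e2 : sign_step t - t = t * (1 - t) * (1 + t) / 2 by rewrite /sign_step; field.
have t2 : t ^+ 2 <= 1 by rewrite expr_le1// ltW.
split.
  apply/andP; split.
    apply: (le_trans st); rewrite -subr_ge0 e2 divr_ge0// !mulr_ge0//; lra.
  by rewrite -subr_ge0 e mulr_ge0//; lra.
rewrite e [leRHS]exprSr; apply: ler_pM => //; [lra|lra|].
have := sqr_ge0 t; lra.
Qed.

Lemma iter_sign_step_norm (s : R) n : `|s| <= 1 -> `|iter n sign_step s| <= 1.
Proof.
have itN t : iter n sign_step (- t) = - iter n sign_step t.
  by elim: n => //= k ->; exact: sign_stepN.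
wlog s0 : s / 0 <= s => [H|].
  have [/H//|s0] := leP 0 s; rewrite -normrN -[in X in _ -> X]normrN -itN; apply: H; lra.
move=> s1; have [->|sn0] := eqVneq s 0.
  by rewrite iter_sign_step0 normr0.
have s01 : 0 < s <= 1 by rewrite lt_def sn0 s0/= (le_trans (ler_norm _)).
have [/andP[h1 h2] _] := iter_sign_step_bounds n s01.
by rewrite ger0_norm// (le_trans _ h1).
Qed.

Lemma cvg_iter_sign_step (s : R) : `|s| <= 1 ->
  iter n sign_step s @[n --> \oo] --> Num.sg s.
Proof.
have itN t n : iter n sign_step (- t) = - iter n sign_step t.
  by elim: n => //= k ->; exact: sign_stepN.
wlog s0 : s / 0 <= s => [H|].
  have [/H//|s0] := leP 0 s => s1.
  rewrite -[s]opprK sgrN; under eq_fun do rewrite itN.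
  by apply: cvgN; apply: H; rewrite ?normrN// oppr_ge0 ltW.
move=> s1; have [->|sn0] := eqVneq s 0.
  by rewrite sgr0; under eq_fun do rewrite iter_sign_step0; exact: cvg_cst.
have s01 : 0 < s <= 1 by rewrite lt_def sn0 s0/= (le_trans (ler_norm _)).
have /andP[sp sl] := s01.
rewrite gtr0_sg//.
have g0 : (1 - s / 2) ^+ n @[n --> \oo] --> (0:R).
  apply: cvg_expr; rewrite ger0_norm; lra.
have : 1 - (1 - s / 2) ^+ n @[n --> \oo] --> (1 - 0 : R).
  by apply: cvgB => //; exact: cvg_cst.
rewrite subr0 => g1.
apply: (squeeze_cvgr _ g1 (cvg_cst (1:R))); apply: nearW => n.
have [/andP[h1 h2] h3] := iter_sign_step_bounds n s01.
by rewrite h2 andbT; lra.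
Qed.

End SignApproximation.

Lemma normc_real (R : realType) (a : R) : normc a%:C%C = `|a|.
Proof. by rewrite /ComplexField.Normc.normc /= expr0n addr0 sqrtr_sqr. Qed.

(** * Uniqueness of Fourier coefficients of integrable functions *)

Section FourierUniqueness.
Variable R : realType.
Local Notation C := R[i].
Local Notation T := (circle R).
Local Notation m := (circle_measure R).
Implicit Types (f g h u v : T -> C).

Lemma fourier_mulz f n :
  fourier (fun z => circle_val z * f z) n = fourier f (n - 1).
Proof.
congr integralC; apply/funext => z.
have -> : - (n - 1) = 1 - n by ring.
by rewrite expfzDr ?circle_neq0// expr1z; ring.
Qed.

Lemma fourier_mulzJ f n :
  fourier (fun z => (circle_val z)^* * f z) n = fourier f (n + 1).
Proof.
congr integralC; apply/funext => z.
have -> : - (n + 1) = - 1 - n by ring.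
by rewrite expfzDr ?circle_neq0// exprN1 circle_conj; ring.
Qed.

Lemma measurableC_exprz n : measurableC (fun z : T => circle_val z ^ n).
Proof.
case: n => n; first exact: measurableC_exprn.
have -> : (fun z : T => circle_val z ^ (Negz n)) = (fun z => (circle_val z ^+ n.+1)^*).
  by apply/funext => z; rewrite rmorphXn /= circle_conj exprVn.
exact/measurableC_conj/measurableC_exprn.
Qed.

Lemma normc_exprz n (z : T) : normc (circle_val z ^ n) = 1 :> R.
Proof.
suff : `|circle_val z ^ n| = 1 by rewrite normcE => -[].
have k1 k : `|circle_val z ^+ k| = 1 by rewrite normrX normr_circle expr1n.
case: n => k; first exact: k1.
by rewrite -[circle_val z ^ Negz k]/(circle_val z ^- k.+1) normfV k1 invr1.
Qed.

Lemma L1_bounded_mul u f (M : R) : measurableC u -> (forall z, normc (u z) <= M) ->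
  L1 f -> L1 (fun z => u z * f z).
Proof.
move=> mu uM f1; have [fR fI] := f1.
have M0 : 0 <= M := le_trans (normc_ge0 _) (uM (circle_param 0)).
have iM := integrableZl measurableT M (integrableD measurableT
  (integrable_norm fR) (integrable_norm fI)).
apply: (@L1_dominated _ _ (fun z => M * (`|complex.Re (f z)| + `|complex.Im (f z)|))).
- by apply: measurableC_mul => //; exact: L1_measurable.
- by apply: eq_integrable iM => // z _ /=.
- move=> z; rewrite ComplexField.Normc.normcM ler_pM ?normc_ge0//.
  rewrite -(@ler_pXn2r _ 2%N) ?nnegrE ?normc_ge0 ?addr_ge0// sqr_normc sqrrD.
  rewrite !real_normK ?num_real//.
  rewrite -subr_ge0 [leRHS](_ : _ = `|complex.Re (f z)| * `|complex.Im (f z)| *+ 2).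
    by rewrite mulrn_wge0 ?mulr_ge0.
  by ring.
Qed.

Lemma L1_exprz n f : L1 f -> L1 (fun z => f z * circle_val z ^ n).
Proof.
move=> f1; under eq_fun do rewrite mulrC.
by apply: (@L1_bounded_mul _ _ 1) => //; [exact: measurableC_exprz|move=> z; rewrite normc_exprz].
Qed.

Definition annihilated f := L1 f /\ forall n, fourier f n = 0.

(* These functions form an algebra which contains the coordinates and is closed
   under bounded pointwise limits, hence contains every Borel indicator. *)
Definition multiplier (g : T -> R) :=
  [/\ measurable_fun setT g, exists M, forall z, `|g z| <= M &
      forall f, annihilated f -> annihilated (fun z => (g z)%:C%C * f z)].

Lemma fourierD f g n : L1 f -> L1 g ->
  fourier (fun z => f z + g z) n = fourier f n + fourier g n.
Proof.
move=> f1 g1; rewrite /fourier -integralCD; [|exact: L1_exprz..].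
by congr integralC; apply/funext => z; rewrite mulrDl.
Qed.

Lemma fourierZ (a : C) f n : L1 f -> fourier (fun z => a * f z) n = a * fourier f n.
Proof.
move=> f1; rewrite /fourier -integralCZ; last exact: L1_exprz.
by congr integralC; apply/funext => z; rewrite mulrA.
Qed.

Lemma annihilatedD f g : annihilated f -> annihilated g ->
  annihilated (fun z => f z + g z).
Proof.
move=> [f1 f0] [g1 g0]; split; first exact: L1D.
by move=> n; rewrite fourierD// f0 g0 addr0.
Qed.

Lemma annihilatedZ (a : C) f : annihilated f -> annihilated (fun z => a * f z).
Proof.
move=> [f1 f0]; split; first exact: L1Z.
by move=> n; rewrite fourierZ// f0 mulr0.
Qed.

Lemma multiplier_cst (a : R) : multiplier (fun=> a).
Proof.
split=> //; first by exists `|a| .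
by move=> f; exact: annihilatedZ.
Qed.

Lemma multiplierD (g h : T -> R) : multiplier g -> multiplier h -> multiplier (fun z => g z + h z).
Proof.
move=> [mg [M gM] ga] [mh [N hN] ha]; split; first exact: measurable_funD.
  by exists (M + N) => z; rewrite (le_trans (ler_normD _ _))// lerD.
move=> f fa; have := annihilatedD (ga _ fa) (ha _ fa).
by under eq_fun do rewrite -mulrDl -rmorphD.
Qed.

Lemma multiplierM (g h : T -> R) : multiplier g -> multiplier h -> multiplier (fun z => g z * h z).
Proof.
move=> [mg [M gM] ga] [mh [N hN] ha]; split; first exact: measurable_funM.
  by exists (M * N) => z; rewrite normrM ler_pM.
move=> f fa; have := ga _ (ha _ fa).
by under eq_fun do rewrite mulrA -rmorphM.
Qed.

Lemma multiplierZ (a : R) (g : T -> R) : multiplier g -> multiplier (fun z => a * g z).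
Proof. exact: multiplierM (multiplier_cst a). Qed.

Lemma multiplierB (g h : T -> R) : multiplier g -> multiplier h -> multiplier (fun z => g z - h z).
Proof.
move=> mg mh; have := multiplierD mg (multiplierZ (-1) mh).
by under eq_fun do rewrite mulN1r.
Qed.

Lemma annihilated_mulz f : annihilated f -> annihilated (fun z => circle_val z * f z).
Proof.
move=> [f1 f0]; split; last by move=> n; rewrite fourier_mulz f0.
apply: (@L1_bounded_mul _ _ 1) => //; first exact: measurableC_id.
by move=> z; rewrite normc_circle.
Qed.

Lemma annihilated_mulzJ f : annihilated f -> annihilated (fun z => (circle_val z)^* * f z).
Proof.
move=> [f1 f0]; split; last by move=> n; rewrite fourier_mulzJ f0.
apply: (@L1_bounded_mul _ _ 1) => //; first exact/measurableC_conj/measurableC_id.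
by move=> z; rewrite normc_conj normc_circle.
Qed.

(** Multiplication by z or conj(z) only shifts the Fourier coefficients, so it preserves their
    vanishing; Re z is the mean of the two. *)
Lemma multiplier_Re : multiplier (fun z => complex.Re (circle_val z)).
Proof.
split; first by case: (measurableC_id R).
  by exists 1 => z; rewrite -(normc_circle z); exact: normr_Re_le.
move=> f fa.
have := annihilatedZ (2^-1) (annihilatedD (annihilated_mulz fa) (annihilated_mulzJ fa)).
congr annihilated; apply/funext => z; rewrite -mulrDl mulrA; congr (_ * _).
by rewrite ReJ_add mulrC.
Qed.

Lemma multiplier_Im : multiplier (fun z => complex.Im (circle_val z)).
Proof.
split; first by case: (measurableC_id R).
  by exists 1 => z; rewrite -(normc_circle z); exact: normr_Im_le.
move=> f fa.
have := annihilatedZ (2^-1 * 'i%C) (annihilatedD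
  (annihilatedZ (-1) (annihilated_mulz fa)) (annihilated_mulzJ fa)).
congr annihilated; apply/funext => z; rewrite mulN1r -mulNr -mulrDl mulrA; congr (_ * _).
by rewrite ImJ_sub [- _ + _]addrC mulrC mulrA.
Qed.

Lemma integral_bounded_limit (h : T -> R) (g_ : nat -> T -> R) (g : T -> R) :
  m.-integrable setT (EFin \o h) ->
  (forall n, measurable_fun setT (g_ n)) -> measurable_fun setT g ->
  (forall n z, `|g_ n z| <= 1) -> (forall z, g_ n z @[n --> \oo] --> g z) ->
  (forall n, \int[m]_z (g_ n z * h z) = 0) -> \int[m]_z (g z * h z) = 0.
Proof.
move=> ih mg_ mg g1 cg g0.
have mh : measurable_fun setT h by apply/measurable_EFinP; exact: measurable_int ih.
have [|||||_ _ /=] := @dominated_convergence _ _ _ m setT measurableT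
  (fun n z => (g_ n z * h z)%:E) (fun z => (g z * h z)%:E) (fun z => `|h z|%:E).
- by move=> n; apply/measurable_EFinP; exact: measurable_funM.
- by apply/measurable_EFinP; exact: measurable_funM.
- apply: aeW => z _; apply: cvgn_EFin; apply: cvgM; [exact: cg|exact: cvg_cst].
- exact: integrable_norm.
- by apply: aeW => z n _; rewrite lee_fin normrM ler_piMl.
move=> cv; rewrite /Rintegral.
have ig n : m.-integrable setT (EFin \o (fun z => g_ n z * h z)).
  apply: le_integrable ih => //.
    by apply/measurable_EFinP; exact: measurable_funM.
  by move=> z _; rewrite /= lee_fin normrM ler_piMl.
have : (fun n => \int[m]_z (g_ n z * h z)%:E)%E = cst 0%E.
  apply/funext => n; have := g0 n; rewrite /Rintegral => H.
  rewrite -[LHS]fineK ?H//. exact: integrable_fin_num (ig n).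
move=> E; rewrite E in cv.
by rewrite (cvg_unique _ cv (cvg_cst _)).
Qed.

(** The n-th coefficient of g f is the integral of g against the fixed integrable function f z^(-n),
    so dominated convergence applies to each component. *)
Lemma multiplier_lim (g_ : nat -> T -> R) (g : T -> R) :
  measurable_fun setT g ->
  (forall n, multiplier (g_ n)) -> (forall n z, `|g_ n z| <= 1) ->
  (forall z, g_ n z @[n --> \oo] --> g z) -> multiplier g.
Proof.
move=> mg mg_ g1 cg.
have g1' z : `|g z| <= 1.
  have /cvg_norm H := cg z.
  by apply: (cvgr_to_le H); apply: nearW => n; exact: g1.
split=> //; first by exists 1.
move=> f [f1 f0].
have L n : L1 (fun z => f z * circle_val z ^ (- n)) by exact: L1_exprz.
split.
  apply: (@L1_bounded_mul (fun z => (g z)%:C%C) _ 1) => //.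
  by move=> z; rewrite normc_real.
move=> n; have [LR LI] := L n.
have key k : integralC (fun z => (g_ k z)%:C%C * f z * circle_val z ^ (- n)) = 0.
  by have [_ _ /(_ f (conj f1 f0))[_ /(_ n)]] := mg_ k.
rewrite /fourier /integralC.
have mg' k : measurable_fun setT (g_ k) by have [] := mg_ k.
congr Complex.
  under eq_Rintegral do rewrite -mulrA ReM /= mul0r subr0.
  apply: (integral_bounded_limit LR mg' mg g1 cg) => k.
  have /(congr1 (@complex.Re R)) /= := key k.
  by under eq_Rintegral do rewrite -mulrA ReM /= mul0r subr0.
under eq_Rintegral do rewrite -mulrA ImM /= mul0r addr0.
apply: (integral_bounded_limit LI mg' mg g1 cg) => k.
have /(congr1 (@complex.Im R)) /= := key k.
by under eq_Rintegral do rewrite -mulrA ImM /= mul0r addr0.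
Qed.

Lemma multiplier_gt (x : T -> R) (r : R) : multiplier x -> (forall z, `|x z| <= 1) ->
  multiplier (\1_[set z | r < x z]).
Proof.
move=> mx x1; have [xm _ _] := mx.
(* Rescaling brings x - r into [-1, 1], where the iterates of [sign_step] converge to the sign
   without changing it. *)
pose c := (1 + `|r|)^-1.
have c0 : 0 < c by rewrite invr_gt0 ltr_wpDr.
pose s z := c * (x z - r).
have ms : multiplier s by apply: multiplierZ; apply: multiplierB => //; exact: multiplier_cst.
have s1 z : `|s z| <= 1.
  rewrite normrM gtr0_norm// /c ler_pdivrMl ?mulr1 ?ltr_wpDr//.
  by rewrite (le_trans (ler_normB _ _))// lerD2r.
have mit n : multiplier (fun z => iter n (@sign_step R) (s z)).
  elim: n => //= n IHn.
  have := multiplierZ 2^-1 (multiplierB (multiplierZ 3 IHn)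
    (multiplierM IHn (multiplierM IHn IHn))).
  congr multiplier; apply/funext => z; rewrite /sign_step; move: (iter _ _ _) => t.
  by field.
have msg : multiplier (fun z => Num.sg (s z)).
  apply: (@multiplier_lim (fun n z => iter n (@sign_step R) (s z))) => //.
  - have [sm _ _] := ms.
    apply: (measurable_fun_cvg (h := fun n z => iter n (@sign_step R) (s z))).
      by move=> n; have [] := mit n.
    by move=> z _; exact: cvg_iter_sign_step.
  - by move=> n z; exact: iter_sign_step_norm.
  - by move=> z; exact: cvg_iter_sign_step.
(* (sg^2 + sg)/2 is 1 on positive arguments and 0 on the others, zero included. *)
have := multiplierZ 2^-1 (multiplierD (multiplierM msg msg) msg).
congr multiplier; apply/funext => z; rewrite indicE.
rewrite /s sgrM (gtr0_sg c0) mul1r.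
case: (ltgtP r (x z)) => rx.
- by rewrite mem_set// gtr0_sg ?subr_gt0// mulr1n; field.
- rewrite memNset /=; last by apply/negP; rewrite -leNgt ltW.
  by rewrite ltr0_sg ?subr_lt0// mulr0n; field.
- by rewrite memNset /= -rx ?ltxx// subrr sgr0 mulr0n; field.
Qed.

Definition multiplier_sets : set (set T) := [set E | multiplier (\1_E)].

Lemma sigma_algebra_multiplier_sets : sigma_algebra setT multiplier_sets.
Proof.
rewrite /multiplier_sets; split => /=.
- by rewrite indic0; exact: multiplier_cst.
- move=> E mE; have := multiplierB (multiplier_cst 1) mE.
  congr multiplier; apply/funext => z; rewrite !indicE in_setD in_setT/=.
  by case: (z \in E) => /=; ring.
move=> F mF.
(* Indicators of finite unions, formed by a + b - a b so as to stay in the algebra; the countable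
   union is their bounded pointwise limit. *)
pose v := fix v n : T -> R := if n is k.+1 then fun z => v k z + \1_(F k) z - v k z * \1_(F k) z
  else fun=> 0.
have mv n : multiplier (v n).
  elim: n => [|n IHn] /=; first exact: multiplier_cst.
  by apply: multiplierB; [exact: multiplierD|exact: multiplierM].
have vE n : v n = \1_(\bigcup_(i < n) F i).
  elim: n => [|n IHn] /=.
    by apply/funext => z; rewrite bigcup_mkord big_ord0 indic0.
  apply/funext => z; rewrite IHn !bigcup_mkord big_ord_recr /= !indicE in_setU.
  by case: (_ \in _); case: (_ \in _) => /=; ring.
have cv z : v n z @[n --> \oo] --> (\1_(\bigcup_i F i) z : R).
  rewrite indicE; have [zF|zF] := boolP (z \in _).
    have [k _ Fk] := set_mem zF.
    apply: cvg_near_cst; exists k.+1 => // n /= kn.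
    rewrite vE indicE mem_set//; exists k => //.
  apply: cvg_near_cst; apply: nearW => n; rewrite vE indicE memNset// => -[k _ Fk].
  by move/negP: zF; apply; rewrite inE; exists k.
apply: (multiplier_lim _ mv _ cv).
  apply: (measurable_fun_cvg (h := v)); first by move=> n; have [] := mv n.
  by move=> z _; exact: cv.
by move=> n z; rewrite vE indicE; case: (_ \in _); rewrite ?normr1 ?normr0.
Qed.

(** For each coordinate, the real sets whose preimage lies in [multiplier_sets] form a sigma-algebra
    containing the open rays, by [multiplier_gt]; the two coordinates generate the sigma-algebra of
    the circle. *)
Lemma multiplier_measurable (E : set T) : measurable E -> multiplier (\1_E).
Proof.
have key (x : T -> R) : multiplier x -> (forall z, `|x z| <= 1) ->
    (@measurable _ R) `<=` image_set_system setT x multiplier_sets.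
  move=> mx x1; rewrite [X in X `<=` _](RGenOInfty.measurableE R).
  apply: smallest_sub.
    by apply: sigma_algebra_image; exact: sigma_algebra_multiplier_sets.
  move=> _ [r ->]; rewrite /image_set_system /= /multiplier_sets /=.
  have := multiplier_gt r mx x1; congr (multiplier (\1_ _)).
  by apply/seteqP; split => z /=; rewrite in_itv/= andbT => // -[].
move=> [B mB <-]; move: B mB.
suff : measurable `<=` image_set_system setT (@circle_coord R) multiplier_sets by exact.
apply: smallest_sub.
  by apply: sigma_algebra_image; exact: sigma_algebra_multiplier_sets.
rewrite subUset; split => _ [A mA <-]; rewrite setTI.
  have := key _ multiplier_Re _ A mA; apply.
  by move=> z; rewrite -(normc_circle z); exact: normr_Re_le.
have := key _ multiplier_Im _ A mA; apply.
by move=> z; rewrite -(normc_circle z); exact: normr_Im_le.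
Qed.

(** The coefficient of index 0 of 1_E f is the integral of f over E. It vanishes for every
    measurable E, which forces both components of f to vanish almost everywhere. *)
Theorem fourier_eq0 f : L1 f -> (forall n, fourier f n = 0) -> f = (fun=> 0) %[ae m].
Proof.
move=> f1 f0; have [fR fI] := f1.
have key E : measurable E -> integralC (fun z => (\1_E z)%:C%C * f z) = 0.
  move=> /multiplier_measurable[_ _ /(_ f)[]//] _ /(_ 0).
  by rewrite /fourier; under eq_fun do rewrite oppr0 expr0z mulr1.
have gen (h : T -> R) : m.-integrable setT (EFin \o h) ->
    (forall E, measurable E -> \int[m]_z (\1_E z * h z) = 0) -> \forall z \ae m, h z = 0.
  move=> ih h0.
  have mh : measurable_fun setT h by apply/measurable_EFinP; exact: measurable_int ih.
  have : ae_eq m setT (EFin \o h) (cst 0%E).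
    apply: integral_ae_eq => // E _ mE; rewrite integral0.
    rewrite integral_mkcond.
    have := h0 _ mE; rewrite /Rintegral => H.
    rewrite [LHS](_ : _ = \int[m]_z (\1_E z * h z)%:E)%E; last first.
      apply: eq_integral => z _; rewrite patchE indicE.
      by case: (_ \in _); rewrite ?mul1r ?mul0r.
    rewrite -[LHS]fineK ?H//; apply: integrable_fin_num => //.
    apply: le_integrable ih => //.
      by apply/measurable_EFinP; apply: measurable_funM => //; exact: measurable_indic.
    move=> z _; rewrite /= lee_fin normrM indicE.
    by case: (_ \in _); rewrite ?normr1 ?mul1r// normr0 mul0r.
  by apply: filterS => z /(_ I) [].
have R0 := gen _ fR; have I0 := gen _ fI.
have {}R0 : \forall z \ae m, complex.Re (f z) = 0.
  apply: R0 => E mE; have /(congr1 (@complex.Re R)) /= := key E mE.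
  by under eq_Rintegral do rewrite ReM /= mul0r subr0.
have {}I0 : \forall z \ae m, complex.Im (f z) = 0.
  apply: I0 => E mE; have /(congr1 (@complex.Im R)) /= := key E mE.
  by under eq_Rintegral do rewrite ImM /= mul0r addr0.
apply: filterS2 R0 I0 => z r0 i0 _.
by apply/eqP; rewrite eq_complex r0 i0 /= eqxx.
Qed.

End FourierUniqueness.

(** * The Hardy space *)

Section Hardy.
Variable R : realType.
Local Notation C := R[i].
Local Notation T := (circle R).
Local Notation m := (circle_measure R).
Implicit Types (f g h u v p q : T -> C).

Lemma exprz_conj (z : T) n : (circle_val z ^ n)^* = circle_val z ^ (- n) :> C.
Proof.
have -> : circle_val z ^ (- n) = (circle_val z ^ n)^-1 by rewrite invr_expz.
have zn0 : circle_val z ^ n != 0 by rewrite expfz_neq0// circle_neq0.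
by apply: (mulfI zn0); rewrite mulfV// mulC_conj normc_exprz expr1n.
Qed.

Lemma fourierE f n : fourier f n = dotC f (fun z => circle_val z ^ n).
Proof. by congr integralC; apply/funext => z; rewrite exprz_conj. Qed.

Lemma L2_bounded u : measurableC u -> bounded_ae u -> L2 u.
Proof.
move=> mu bu; have := L2_bounded_mul mu bu (L2_cst (1 : C)).
by under eq_fun do rewrite mulr1.
Qed.

Lemma bounded_exprz n : bounded_ae (fun z : T => circle_val z ^ n).
Proof. by exists 1; apply: aeW => z; rewrite normc_exprz. Qed.

Lemma L2_exprz n : L2 (fun z : T => circle_val z ^ n).
Proof. exact: L2_bounded (measurableC_exprz R n) (bounded_exprz n). Qed.

Lemma L2_mulz f : L2 f -> L2 (fun z => circle_val z * f z).
Proof.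
apply: L2_bounded_mul; first exact: measurableC_id.
exact: (bounded_exprz 1).
Qed.

Lemma L2_mulzJ f : L2 f -> L2 (fun z => (circle_val z)^* * f z).
Proof.
apply: L2_bounded_mul; first exact/measurableC_conj/measurableC_id.
by exists 1; apply: aeW => z; rewrite normc_conj normc_circle.
Qed.

Lemma integralC_exprz n : integralC (fun z : T => circle_val z ^ n) = (n == 0)%:R.
Proof.
case: n => [[|n]|n].
- by under eq_fun do rewrite expr0z; rewrite integralC1.
- by rewrite (@integralC_exprn R n.+1).
- have -> : (fun z : T => circle_val z ^ Negz n) = (fun z => (circle_val z ^+ n.+1)^*).
    by apply/funext => z; rewrite exprnP exprz_conj NegzE.
  rewrite integralC_conj; first by rewrite integralC_exprn// rmorph0.
  exact: L2_L1 (L2_exprz n.+1).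
Qed.

Lemma fourier_exprz k n : fourier (fun z : T => circle_val z ^ k) n = (k == n)%:R.
Proof.
rewrite -subr_eq0 -integralC_exprz; congr integralC; apply/funext => z.
by rewrite -expfzDr// circle_neq0.
Qed.

Lemma fourier_conj f n : L2 f -> fourier (fun z => (f z)^*) n = (fourier f (- n))^*.
Proof.
move=> f2; rewrite /fourier -integralC_conj; last first.
  by apply: L1_exprz; exact: L2_L1.
by congr integralC; apply/funext => z; rewrite rmorphM /= exprz_conj opprK.
Qed.

Lemma fourier_ae f g n : measurableC f -> measurableC g -> f = g %[ae m] ->
  fourier f n = fourier g n.
Proof.
move=> mf mg fg; rewrite !fourierE; apply: dotC_ae => //; last exact: ae_eq_refl.
  exact: measurableC_exprz.
exact: measurableC_exprz.
Qed.

Lemma fourierB f g n : L2 f -> L2 g ->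
  fourier (fun z => f z - g z) n = fourier f n - fourier g n.
Proof. by move=> f2 g2; rewrite !fourierE dotCBl//; exact: L2_exprz. Qed.

Definition cvgL2 (f_ : nat -> T -> C) f := forall e : R, 0 < e ->
  exists N, forall n, (N <= n)%N -> normL2 (fun z => f_ n z - f z) <= e.

(** The form in which later limit arguments are concluded. [K] carries no sign condition, whence the
    auxiliary constant |K| + 1. *)
Lemma normc_eq0_le (a : C) (K : R) :
  (forall e : R, 0 < e -> normc a <= K * e) -> a = 0.
Proof.
move=> H; apply: ComplexField.Normc.eq0_normc; apply/eqP.
rewrite eq_le normc_ge0 andbT leNgt; apply/negP => a0.
pose L := `|K| + 1.
have L0 : 0 < L by rewrite ltr_wpDl.
have := H (normc a / L / 2); rewrite !divr_gt0// => /(_ isT).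
apply/negP; rewrite -ltNge.
apply: (@le_lt_trans _ _ (L * (normc a / L / 2))).
  rewrite ler_wpM2r ?divr_ge0 ?normc_ge0 ?(ltW L0)// /L.
  by rewrite (le_trans (ler_norm K))// lerDl.
rewrite [ltLHS](_ : _ = normc a / 2); last by field; rewrite gt_eqF.
lra.
Qed.

(** Cauchy-Schwarz. Eventual constancy is enough for the applications, since each Fourier
    coefficient of the partial sums stabilizes. *)
Lemma cvgL2_dotC (f_ : nat -> T -> C) f g (c : C) N : (forall n, L2 (f_ n)) -> L2 f -> L2 g ->
  cvgL2 f_ f -> (forall n, (N <= n)%N -> dotC (f_ n) g = c) -> dotC f g = c.
Proof.
move=> f_2 f2 g2 cf fc; apply/eqP; rewrite -subr_eq0 -oppr_eq0 opprB; apply/eqP.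
apply: (@normc_eq0_le _ (normL2 g)) => e e0; have [M MP] := cf e e0.
rewrite -(fc (maxn M N)) ?leq_maxr// -dotCBl//.
rewrite (le_trans (CauchySchwarz (L2B (f_2 _) f2) g2))// mulrC.
by rewrite ler_wpM2l ?normL2_ge0// MP// leq_maxl.
Qed.

Definition zpoly (c : nat -> C) n : T -> C := fun z => \sum_(k < n) c k * circle_val z ^+ k.

Lemma zpoly0 c : zpoly c 0 = fun=> 0.
Proof. by apply/funext => z; rewrite /zpoly big_ord0. Qed.

Lemma zpolyS c n : zpoly c n.+1 = fun z => zpoly c n z + c n * circle_val z ^ n.
Proof. by apply/funext => z; rewrite /zpoly big_ord_recr. Qed.

Lemma L2_zpoly c n : L2 (zpoly c n).
Proof.
elim: n => [|n IHn]; first by rewrite zpoly0; exact: L2_cst.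
by rewrite zpolyS; apply: L2D => //; apply: L2Z; exact: L2_exprz.
Qed.

Lemma dotC_zpoly f c n : L2 f -> dotC f (zpoly c n) = \sum_(k < n) (c k)^* * fourier f k.
Proof.
move=> f2; elim: n => [|n IHn]; first by rewrite zpoly0 dotC0r big_ord0.
rewrite zpolyS dotCDr//; [|exact: L2_zpoly|exact/L2Z/L2_exprz].
by rewrite dotCZr//; [rewrite big_ord_recr /= IHn fourierE|exact: L2_exprz].
Qed.

Lemma fourier_zpoly c n (i : nat) : fourier (zpoly c n) i = if (i < n)%N then c i else 0.
Proof.
elim: n => [|n IHn]; first by rewrite zpoly0 fourierE dotC0l.
have L := L2Z (c n) (L2_exprz n).
rewrite zpolyS fourierD ?fourierZ ?IHn ?fourier_exprz; last 3 first.
- exact/L2_L1/L2_exprz.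
- exact/L2_L1/L2_zpoly.
- exact: L2_L1.
have -> : (n%:Z == i%:Z) = (n == i) by [].
rewrite ltnS; case: (ltngtP i n) => ni.
- by rewrite mulr0 addr0.
- by rewrite mulr0 addr0.
- by rewrite ni mulr1 add0r.
Qed.

Lemma fourier_zpoly_neg c n (i : int) : i < 0 -> fourier (zpoly c n) i = 0.
Proof.
move=> i0; elim: n => [|n IHn]; first by rewrite zpoly0 fourierE dotC0l.
have L := L2Z (c n) (L2_exprz n).
rewrite zpolyS fourierD ?fourierZ ?IHn ?fourier_exprz; last 3 first.
- exact/L2_L1/L2_exprz.
- exact/L2_L1/L2_zpoly.
- exact: L2_L1.
by case: i i0 {IHn} => // i _; rewrite mulr0 addr0.
Qed.

Lemma pythagoras f g : L2 f -> L2 g -> dotC f g = 0 ->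
  normL2 (fun z => f z + g z) ^+ 2 = normL2 f ^+ 2 + normL2 g ^+ 2.
Proof.
move=> f2 g2 fg; apply: (@complexI R).
rewrite rmorphD /= -!dotCff//; last exact: L2D.
rewrite dotCDl//; last exact: L2D.
by rewrite !dotCDr// -(dotC_conj f2 g2) fg conjC0 addr0 add0r.
Qed.

(** Only the frequencies 0, ..., n-1 enter: for a general f in L2 these are the Taylor polynomials
    of its projection onto H2. *)
Definition psum f n := zpoly (fun k => fourier f k) n.

Lemma psum_orth f n k c : L2 f -> (k <= n)%N ->
  dotC (fun z => f z - psum f n z) (zpoly c k) = 0.
Proof.
move=> f2 kn; rewrite dotC_zpoly; last by apply: L2B => //; exact: L2_zpoly.
apply: big1 => i _; rewrite fourierB//; last exact: L2_zpoly.
by rewrite fourier_zpoly (leq_trans (ltn_ord i) kn) subrr mulr0.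
Qed.

Lemma normL2_psumB f n k : L2 f -> (k <= n)%N ->
  normL2 (psum f n) ^+ 2 =
  normL2 (fun z => psum f n z - psum f k z) ^+ 2 + normL2 (psum f k) ^+ 2.
Proof.
move=> f2 kn; rewrite -pythagoras; [|apply: L2B; exact: L2_zpoly|exact: L2_zpoly|].
  by congr (normL2 _ ^+ 2); apply/funext => z; rewrite subrK.
rewrite dotC_zpoly; last by apply: L2B; exact: L2_zpoly.
apply: big1 => i _; rewrite fourierB; [|exact: L2_zpoly..].
by rewrite !fourier_zpoly ltn_ord (leq_trans (ltn_ord i) kn) subrr mulr0.
Qed.

Lemma normL2_psum_le f n : L2 f -> normL2 (psum f n) <= normL2 f.
Proof.
move=> f2; rewrite -(@ler_pXn2r _ 2%N) ?nnegrE ?normL2_ge0//.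
have : normL2 (fun z => (f z - psum f n z) + psum f n z) ^+ 2 = _ :=
  pythagoras (L2B f2 (L2_zpoly _ _)) (L2_zpoly _ _) (psum_orth _ f2 (leqnn n)).
by under eq_fun do rewrite subrK; move=> ->; rewrite lerDr sqr_ge0.
Qed.

(** The squared norms increase and are bounded by Bessel's inequality, hence converge; by Pythagoras
    their differences are the squared distances between partial sums. *)
Lemma psum_cauchy f : L2 f -> forall e : R, 0 < e -> exists N, forall n k,
  (N <= n)%N -> (N <= k)%N -> normL2 (fun z => psum f n z - psum f k z) <= e.
Proof.
move=> f2 e e0.
pose a n := normL2 (psum f n) ^+ 2.
have ca : cvgn a.
  apply: nondecreasing_is_cvgn.
    move=> k n kn; rewrite /a (normL2_psumB f2 kn) lerDr sqr_ge0//.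
  exists (normL2 f ^+ 2) => _ [n _ <-].
  by rewrite ler_pXn2r ?nnegrE ?normL2_ge0// normL2_psum_le.
have e20 : 0 < e ^+ 2 / 2 by rewrite divr_gt0// exprn_gt0.
have [N _ NP] : \forall n \near \oo, `|limn a - a n| < e ^+ 2 / 2.
  by move/cvgrPdist_lt : ca => /(_ _ e20).
exists N => n k.
wlog kn : n k / (k <= n)%N => [H Nn Nk|Nn Nk].
  have /orP[kn|nk] := leq_total k n; first exact: H.
  by rewrite normL2_sym; [exact: H|exact: L2_zpoly..].
rewrite -(@ler_pXn2r _ 2%N) ?nnegrE ?normL2_ge0 ?ltW//.
have := normL2_psumB f2 kn; rewrite -/(a n) -/(a k).
have := NP n Nn; have := NP k Nk; rewrite /= !ltr_norml => /andP[? ?] /andP[? ?].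
lra.
Qed.

Lemma H2_L2 f : H2 f -> L2 f. Proof. by case. Qed.

Lemma L2_measurable f : L2 f -> measurableC f. Proof. by case. Qed.

Lemma psum_cvg_ex f : L2 f -> exists2 g, H2 g & cvgL2 (psum f) g /\
  forall n : nat, fourier g n = fourier f n.
Proof.
move=> f2; have [g g2 cg] := L2_complete (fun n => L2_zpoly _ n) (psum_cauchy f2).
exists g; first split => //.
  move=> n n0; rewrite fourierE.
  apply: (@cvgL2_dotC (psum f) g _ 0 0) => //; [exact: L2_zpoly|exact: L2_exprz|].
  by move=> k _; rewrite -fourierE fourier_zpoly_neg.
split=> // n; rewrite fourierE.
(* The frequency n enters [psum f k] only for k > n. *)
apply: (@cvgL2_dotC (psum f) g _ _ n.+1) => //; [exact: L2_zpoly|exact: L2_exprz|].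
by move=> k nk; rewrite -fourierE fourier_zpoly nk.
Qed.

Lemma L2_fourier_eq0 f : L2 f -> (forall n, fourier f n = 0) -> f = (fun=> 0) %[ae m].
Proof. by move=> f2; apply: fourier_eq0; exact: L2_L1. Qed.

(** The partial sums converge to some g in H2 with the same coefficients as f, and uniqueness of
    Fourier coefficients identifies g with f. *)
Lemma psum_cvg f : H2 f -> cvgL2 (psum f) f.
Proof.
move=> [f2 f0]; have [g [g2 g0] [cg gf]] := psum_cvg_ex f2.
have fg : f = g %[ae m].
  have : (fun z => f z - g z) = (fun=> 0) %[ae m].
    apply: L2_fourier_eq0; first exact: L2B.
    case=> n; rewrite fourierB//; first by rewrite gf subrr.
    by rewrite f0// g0// subrr.
  by apply: filterS => z /(_ I)/subr0_eq.
move=> e /cg[N NP]; exists N => n /NP; congr (_ <= e); apply: normL2_ae.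
- exact/L2_measurable/L2B/g2/L2_zpoly.
- exact/L2_measurable/L2B/f2/L2_zpoly.
- by apply: filterS fg => z /(_ I) ->.
Qed.

(** h is a limit of polynomials, and pairing f with a polynomial involves only the nonnegative
    coefficients of f. *)
Lemma orth_H2 f h : L2 f -> (forall n : nat, fourier f n = 0) -> H2 h -> dotC f h = 0.
Proof.
move=> f2 f0 hH; have [h2 _] := hH.
rewrite -dotC_conj//.
suff -> : dotC h f = 0 by rewrite conjC0.
apply: (@cvgL2_dotC (psum h) h _ 0 0) => //; [exact: L2_zpoly|exact: psum_cvg|].
move=> n _; rewrite -dotC_conj//; last exact: L2_zpoly.
by rewrite dotC_zpoly// big1 ?conjC0// => i _; rewrite f0 mulr0.
Qed.

Lemma H2_proj_ex f : L2 f -> exists2 g, H2 g &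
  forall h, H2 h -> dotC (fun z => f z - g z) h = 0.
Proof.
move=> f2; have [g gH [_ gf]] := psum_cvg_ex f2; exists g => // h hH.
apply: orth_H2 => //; first exact/L2B/H2_L2.
by move=> n; rewrite fourierB ?gf ?subrr//; exact: H2_L2.
Qed.

Lemma H2_ae f g : H2 f -> L2 g -> f = g %[ae m] -> H2 g.
Proof.
move=> [f2 f0] g2 fg; split => // n n0.
by rewrite -(fourier_ae _ _ _ fg) ?f0//; exact: L2_measurable.
Qed.

Lemma H2D f g : H2 f -> H2 g -> H2 (fun z => f z + g z).
Proof.
move=> [f2 f0] [g2 g0]; split; first exact: L2D.
by move=> n n0; rewrite fourierD ?f0 ?g0 ?addr0//; exact: L2_L1.
Qed.

Lemma H2Z (a : C) f : H2 f -> H2 (fun z => a * f z).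
Proof.
move=> [f2 f0]; split; first exact: L2Z.
by move=> n n0; rewrite fourierZ ?f0 ?mulr0//; exact: L2_L1.
Qed.

Lemma H2B f g : H2 f -> H2 g -> H2 (fun z => f z - g z).
Proof.
move=> [f2 f0] [g2 g0]; split; first exact: L2B.
by move=> n n0; rewrite fourierB ?f0 ?g0 ?subr0.
Qed.

Lemma fourier_cst (a : C) n : fourier (fun=> a) n = a * (n == 0)%:R.
Proof.
have := fourierZ a n (L2_L1 (L2_exprz 0)); rewrite fourier_exprz eq_sym => <-.
by congr fourier; apply/funext => z; rewrite expr0z mulr1.
Qed.

Lemma H2_cst (a : C) : H2 (fun=> a).
Proof.
split; first exact: L2_cst.
by move=> n n0; rewrite fourier_cst (lt_eqF n0) mulr0.
Qed.

Lemma H2_exprn n : H2 (fun z : T => circle_val z ^+ n).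
Proof.
split; first exact: (L2_exprz (Posz n)).
by move=> k k0; rewrite (fourier_exprz n); case: k k0.
Qed.

Lemma H2_mulz f : H2 f -> H2 (fun z => circle_val z * f z).
Proof.
move=> [f2 f0]; split; first exact: L2_mulz.
by move=> n n0; rewrite fourier_mulz f0// ltrBlDr (lt_trans n0).
Qed.

(** The orthogonality of conj(z H2) and H2 in bilinear form: conj(z f) has no nonnegative
    frequency. *)
Lemma integralC_mulz_H2 f h : H2 f -> H2 h ->
  integralC (fun z => circle_val z * f z * h z) = 0.
Proof.
move=> fH hH; have [f2 f0] := fH; have zf2 := L2_mulz f2.
have : dotC (fun z => (circle_val z * f z)^*) h = 0.
  apply: orth_H2 => //; first exact: L2_conj.
  by move=> n; rewrite fourier_conj// fourier_mulz f0 ?conjC0//; case: n.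
rewrite /dotC (_ : (fun z => _) = (fun z => (circle_val z * f z * h z)^*)); last first.
  by apply/funext => z; rewrite [RHS]rmorphM.
rewrite integralC_conj; last exact/L2M/H2_L2.
by move/eqP; rewrite conjC_eq0 => /eqP.
Qed.

(** Boundedness of u puts the product in L2; its coefficient at -(n+1) is the integral of z (z^n u)
    f, zero by [integralC_mulz_H2]. *)
Lemma H2_bounded_mul u f : H2 u -> bounded_ae u -> H2 f -> H2 (fun z => u z * f z).
Proof.
move=> uH ub fH; have [u2 _] := uH; have [f2 f0] := fH.
split; first by apply: L2_bounded_mul => //; exact: L2_measurable.
have key (k : nat) g : H2 g -> H2 (fun z => circle_val z ^+ k * g z).
  elim: k g => [|k IHk] g gH; first by under eq_fun do rewrite expr0 mul1r.
  by under eq_fun do rewrite exprS -mulrA; exact/H2_mulz/IHk.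
case=> // n _; rewrite -[RHS](integralC_mulz_H2 (key n _ uH) fH).
congr integralC; apply/funext => z.
by rewrite NegzE opprK -exprnP exprS; ring.
Qed.

(** Division by z is written with conj(z), so that [kt0 u] unfolds to the same term as
    [bshift u]. *)
Definition bshift f : T -> C := fun z => (circle_val z)^* * (f z - at0 f).

Lemma bshiftK f z : at0 f + circle_val z * bshift f z = f z.
Proof. by rewrite mulrA circle_mul_conj mul1r addrC subrK. Qed.

Lemma at0E f : at0 f = dotC f (fun=> 1).
Proof. by congr integralC; apply/funext => z; rewrite oppr0 expr0z conjC1. Qed.

Lemma bshift_H2 f : H2 f -> H2 (bshift f).
Proof.
move=> [f2 f0]; have c2 : L2 (fun z : T => at0 f) by exact: L2_cst.
split; first exact/L2_mulzJ/L2B.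
move=> n n0; rewrite fourier_mulzJ fourierB//.
rewrite fourier_cst; have [n1|n1] := eqVneq (n + 1) 0.
  by rewrite n1 mulr1 subrr.
by rewrite f0 ?mulr0 ?subrr//; lia.
Qed.

End Hardy.

(** * Model spaces *)

Section ModelSpace.
Variable R : realType.
Local Notation C := R[i].
Local Notation T := (circle R).
Local Notation m := (circle_measure R).
Implicit Types (f g h u v p q : T -> C).

Lemma inner_H2 u : inner u -> H2 u. Proof. by case. Qed.

Lemma inner_L2 u : inner u -> L2 u. Proof. by case=> -[]. Qed.

Lemma inner_measurable u : inner u -> measurableC u.
Proof. by case=> -[[]]. Qed.

Lemma inner_bounded u : inner u -> bounded_ae u.
Proof.
case=> _ u1; exists 1; apply: filterS u1 => z; rewrite normcE => -[->].
exact: lexx.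
Qed.

Lemma inner_mulJ u : inner u -> \forall z \ae m, u z * (u z)^* = 1.
Proof.
case=> _; apply: filterS => z; rewrite normcE => -[u1].
by rewrite mulC_conj u1 expr1n.
Qed.

Lemma inner_normL2 u f : inner u -> L2 f -> normL2 (fun z => u z * f z) = normL2 f.
Proof.
move=> iu; apply: normL2_unimodular_mul; first exact: inner_measurable.
by case: iu.
Qed.

Lemma inner_L2_mul u f : inner u -> L2 f -> L2 (fun z => u z * f z).
Proof.
by move=> iu; apply: L2_bounded_mul; [exact: inner_measurable|exact: inner_bounded].
Qed.

Lemma inner_L2_mulJ u f : inner u -> L2 f -> L2 (fun z => (u z)^* * f z).
Proof.
move=> iu; apply: L2_bounded_mul; first exact/measurableC_conj/inner_measurable.
have [M uM] := inner_bounded iu; exists M.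
by apply: filterS uM => z; rewrite normc_conj.
Qed.

Lemma inner_H2_mul u f : inner u -> H2 f -> H2 (fun z => u z * f z).
Proof.
by move=> iu; apply: H2_bounded_mul; [exact: inner_H2|exact: inner_bounded].
Qed.

Lemma dotC_mulJ u f g : dotC (fun z => (u z)^* * f z) g = dotC f (fun z => u z * g z).
Proof. by congr integralC; apply/funext => z; rewrite rmorphM /=; ring. Qed.

Lemma dotC_mulr u f g : dotC f (fun z => (u z)^* * g z) = dotC (fun z => u z * f z) g.
Proof.
by congr integralC; apply/funext => z; rewrite rmorphM /= conjCK; ring.
Qed.

Lemma dotC_aeL f f' g : L2 f -> L2 f' -> L2 g -> f = f' %[ae m] -> dotC f g = dotC f' g.
Proof.
by move=> f2 f'2 g2 ff'; apply: dotC_ae => //; try exact: L2_measurable; exact: ae_eq_refl.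
Qed.

Lemma dotC_aeR f g g' : L2 f -> L2 g -> L2 g' -> g = g' %[ae m] -> dotC f g = dotC f g'.
Proof.
by move=> f2 g2 g'2 gg'; apply: dotC_ae => //; try exact: L2_measurable; exact: ae_eq_refl.
Qed.

Lemma dotC_inner_mul u f g : inner u -> L2 f -> L2 g ->
  dotC (fun z => u z * f z) (fun z => u z * g z) = dotC f g.
Proof.
move=> iu f2 g2; rewrite -dotC_mulJ; apply: dotC_aeL => //.
  by apply: inner_L2_mulJ => //; exact: inner_L2_mul.
apply: filterS (inner_mulJ iu) => z uz _.
by rewrite mulrA [_^* * _]mulrC uz mul1r.
Qed.

Lemma K2_H2 u f : K2 u f -> H2 f. Proof. by case. Qed.

Lemma K2_L2 u f : K2 u f -> L2 f. Proof. by case=> -[]. Qed.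

Lemma K2D u f g : inner u -> K2 u f -> K2 u g -> K2 u (fun z => f z + g z).
Proof.
move=> iu [fH fo] [gH go]; split; first exact: H2D.
move=> h hH; rewrite dotCDl ?fo ?go ?addr0//; [exact: H2_L2..|].
exact/H2_L2/inner_H2_mul.
Qed.

Lemma K2Z u (a : C) f : inner u -> K2 u f -> K2 u (fun z => a * f z).
Proof.
move=> iu [fH fo]; split; first exact: H2Z.
move=> h hH; rewrite dotCZl ?fo ?mulr0//; first exact: H2_L2.
exact/H2_L2/inner_H2_mul.
Qed.

Lemma K2B u f g : inner u -> K2 u f -> K2 u g -> K2 u (fun z => f z - g z).
Proof.
move=> iu fK gK; have := K2D iu fK (K2Z (-1) iu gK).
by under eq_fun do rewrite mulN1r.
Qed.

Lemma K2_ae u f g : inner u -> K2 u f -> L2 g -> f = g %[ae m] -> K2 u g.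
Proof.
move=> iu [fH fo] g2 fg; split; first exact: H2_ae fg.
move=> h hH; rewrite -(fo h hH); apply: dotC_aeL => //; [exact: H2_L2| |].
  exact/H2_L2/inner_H2_mul.
by apply: filterS fg => z /(_ I).
Qed.

(** Moving conj(z) across gives <f - f(0), u z h>: f is orthogonal to u H2, and constants are
    orthogonal to z u h. *)
Lemma K2_bshift u f : inner u -> K2 u f -> K2 u (bshift f).
Proof.
move=> iu [fH fo]; split; first exact: bshift_H2.
move=> h hH; rewrite dotC_mulJ.
have zhH := H2_mulz hH; have uhH := inner_H2_mul iu hH.
rewrite dotCBl; [|exact: H2_L2|exact: L2_cst|exact/H2_L2/H2_mulz].
rewrite (_ : (fun z => circle_val z * _) = (fun z => u z * (circle_val z * h z))); last first.
  by apply/funext => z; ring.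
rewrite fo// sub0r.
have -> : dotC (fun=> at0 f) (fun z => u z * (circle_val z * h z)) =
    at0 f * (integralC (fun z => circle_val z * u z * h z))^*.
  rewrite -integralC_conj; last first.
    by apply: L2M; apply: H2_L2 => //; apply/H2_mulz; exact: inner_H2.
  rewrite -integralCZ; last first.
    by apply/L1_conj/L2M; apply: H2_L2 => //; apply/H2_mulz; exact: inner_H2.
  by congr integralC; apply/funext => z; congr (_ * _^*); ring.
by rewrite integralC_mulz_H2 ?conjC0 ?mulr0 ?oppr0//; exact: inner_H2.
Qed.

Lemma conjK_L2 u f : inner u -> L2 f -> L2 (conjK u f).
Proof. by move=> iu f2; apply: inner_L2_mul => //; exact/L2_conj/L2_mulz. Qed.

(** C_u exchanges the two conditions defining K2: orthogonality of f to u z^n kills the coefficient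
    of C_u f at -(n+1), and f in H2 makes C_u f orthogonal to u H2. *)
Lemma K2_conjK u f : inner u -> K2 u f -> K2 u (conjK u f).
Proof.
move=> iu [fH fo]; have [f2 f0] := fH; have uf2 := conjK_L2 iu f2.
split; first split => //.
  case=> // n _.
  have zuH := H2_exprn R n.
  have := fo _ zuH; rewrite -dotC_conj; [|exact/H2_L2/inner_H2_mul|exact: H2_L2].
  move/eqP; rewrite conjC_eq0 => /eqP <-; congr integralC; apply/funext => z.
  rewrite /conjK rmorphM /= circle_conj NegzE opprK -exprnP exprS.
  by field; exact: circle_neq0.
move=> h hH; rewrite dotC_inner_mul//; [|exact/L2_conj/L2_mulz|exact: H2_L2].
rewrite -[RHS]conjC0 -(integralC_mulz_H2 fH hH) -integralC_conj; last first.
  by apply: L2M; [exact: L2_mulz|exact: H2_L2].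
by congr integralC; apply/funext => z; rewrite !rmorphM.
Qed.

Lemma conjKK u f : inner u -> conjK u (conjK u f) = f %[ae m].
Proof.
move=> iu; apply: filterS (inner_mulJ iu) => z uz _.
rewrite /conjK !rmorphM /= !conjCK.
transitivity ((u z * (u z)^*) * (circle_val z * (circle_val z)^*) * f z); first by ring.
by rewrite uz circle_mul_conj !mul1r.
Qed.

Lemma normL2_conjK u f : inner u -> L2 f -> normL2 (conjK u f) = normL2 f.
Proof.
move=> iu f2; rewrite /conjK inner_normL2//; last exact/L2_conj/L2_mulz.
congr Num.sqrt; apply: eq_Rintegral => z _.
by rewrite normc_conj ComplexField.Normc.normcM normc_circle mul1r.
Qed.

Lemma bounded_conjK u f : inner u -> bounded_ae f -> bounded_ae (conjK u f).
Proof.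
move=> [_ u1] [M fM]; exists M; apply: filterS2 u1 fM => z; rewrite normcE => -[uz] fz.
rewrite /conjK ComplexField.Normc.normcM uz normc_conj mul1r.
by rewrite ComplexField.Normc.normcM normc_circle mul1r.
Qed.

(** With P the projection onto H2, the witness is P f - u P(conj(u) f): multiplication by u is an
    isometry of H2 onto u H2, so the projection onto u H2 is u P conj(u). *)
Lemma PK_ex u f : inner u -> L2 f -> exists p, K2 u p /\
  forall g, K2 u g -> dotC (fun z => f z - p z) g = 0.
Proof.
move=> iu f2; have [g1 g1H g1o] := H2_proj_ex f2.
have uf2 := inner_L2_mulJ iu f2.
have [q qH qo] := H2_proj_ex uf2.
have uqH := inner_H2_mul iu qH.
exists (fun z => g1 z - u z * q z); split; first split.
- exact: H2B.
- move=> h hH; have uhH := inner_H2_mul iu hH.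
  rewrite dotCBl; [|exact: H2_L2..].
  rewrite dotC_inner_mul//; [|exact: H2_L2..].
  have := g1o _ uhH; rewrite dotCBl//; [|exact: H2_L2..].
  move/subr0_eq => <-; rewrite -dotC_mulJ.
  by have := qo _ hH; rewrite dotCBl//; exact: H2_L2.
move=> g [gH go].
have -> : (fun z => f z - (g1 z - u z * q z)) = (fun z => (f z - g1 z) + u z * q z).
  by apply/funext => z; ring.
rewrite dotCDl; [|exact/L2B/H2_L2|exact: H2_L2..].
rewrite g1o// add0r -dotC_conj; [|exact: H2_L2..].
by rewrite go// conjC0.
Qed.

Lemma PKP u f : inner u -> L2 f -> K2 u (PK u f) /\
  forall g, K2 u g -> dotC (fun z => f z - PK u f z) g = 0.
Proof.
move=> iu f2; have [p pP] := PK_ex iu f2.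
exact: (@xgetPex _ (fun=> 0) [set p | K2 u p /\
  forall g, K2 u g -> dotC (fun z => f z - p z) g = 0] (ex_intro _ p pP)).
Qed.

Lemma PK_K2 u f : inner u -> L2 f -> K2 u (PK u f).
Proof. by move=> iu f2; have [] := PKP iu f2. Qed.

Lemma dotC_PK u f g : inner u -> L2 f -> K2 u g -> dotC (PK u f) g = dotC f g.
Proof.
move=> iu f2 gK; have [pK po] := PKP iu f2.
have := po g gK; rewrite dotCBl//; [|exact: K2_L2 pK|exact: K2_L2 gK].
by move/subr0_eq.
Qed.

Lemma K2_eq u f g : inner u -> K2 u f -> K2 u g ->
  (forall h, K2 u h -> dotC f h = dotC g h) -> f = g %[ae m].
Proof.
move=> iu fK gK fg; have fgK := K2B iu fK gK.
have : (fun z => f z - g z) = (fun=> 0) %[ae m].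
  apply: dotC_eq0; first exact: K2_L2 fgK.
  by rewrite dotCBl ?fg ?subrr//; [exact: K2_L2 fK|exact: K2_L2 gK|exact: K2_L2 fgK].
by apply: filterS => z /(_ I)/subr0_eq.
Qed.

Lemma PK_unique u f p : inner u -> L2 f -> K2 u p ->
  (forall g, K2 u g -> dotC f g = dotC p g) -> PK u f = p %[ae m].
Proof.
move=> iu f2 pK fp; apply: (K2_eq iu) => //; first exact: PK_K2.
by move=> h hK; rewrite dotC_PK// fp.
Qed.

Lemma K2_orth_u u g : inner u -> K2 u g -> dotC u g = 0.
Proof.
move=> iu [gH go]; have := go _ (H2_cst (1 : C)).
under eq_fun do rewrite mulr1.
by rewrite -dotC_conj; [move/eqP; rewrite conjC_eq0 => /eqP|exact: inner_L2|exact: H2_L2].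
Qed.

(** Apply C_u to f = f(0) + z B f. The term in u is orthogonal to K2 u, which is how S_u C_u = C_u B
    arises. *)
Lemma mulz_conjK u f z : circle_val z * conjK u f z =
  conjK u (bshift f) z + (at0 f)^* * u z.
Proof.
rewrite /conjK -[in LHS](bshiftK f z) !rmorphM rmorphD rmorphM /=.
transitivity ((circle_val z * (circle_val z)^*) *
    (u z * ((at0 f)^* + (circle_val z)^* * (bshift f z)^*))); first by ring.
by rewrite circle_mul_conj ?rmorphM /=; ring.
Qed.

Lemma SK_conjK u f : inner u -> K2 u f ->
  SK u (conjK u f) = conjK u (bshift f) %[ae m].
Proof.
move=> iu fK; have f2 := K2_L2 fK.
have BK := K2_conjK iu (K2_bshift iu fK).
have zc2 := L2_mulz (conjK_L2 iu f2).
apply: (PK_unique iu) => // g gK.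
have -> : (fun z => circle_val z * conjK u f z) =
    (fun z => conjK u (bshift f) z + (at0 f)^* * u z).
  by apply/funext => z; exact: mulz_conjK.
rewrite dotCDl; [|exact: K2_L2 BK|exact/L2Z/inner_L2|exact: K2_L2 gK].
rewrite dotCZl; [|exact: inner_L2|exact: K2_L2 gK].
by rewrite (K2_orth_u iu gK) mulr0 addr0.
Qed.

(** [bshift g] is a witness, z f being orthogonal to constants; hence the [xget] in [adjoint]
    returns a genuine adjoint vector and not its default value. *)
Lemma adjoint_SK u g : inner u -> K2 u g ->
  K2 u (adjoint (K2 u) (SK u) g) /\
  forall f, K2 u f -> dotC (SK u f) g = dotC f (adjoint (K2 u) (SK u) g).
Proof.
move=> iu gK; have g2 := K2_L2 gK.
apply: (@xgetPex _ (fun=> 0) [set h | K2 u h /\ forall f, K2 u f -> dotC (SK u f) g = dotC f h]).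
exists (bshift g); split; first exact: K2_bshift.
move=> f fK; have f2 := K2_L2 fK.
rewrite dotC_PK//; last exact: L2_mulz.
rewrite dotC_mulr dotCBr//; [|exact: L2_cst|exact: L2_mulz].
suff -> : dotC (fun z => circle_val z * f z) (fun=> at0 g) = 0 by rewrite subr0.
exact: integralC_mulz_H2 (K2_H2 fK) (H2_cst (at0 g)^*).
Qed.

Lemma dotC_kt0 u f : inner u -> K2 u f -> dotC f (kt0 u) = dotC (fun z => circle_val z * f z) u.
Proof.
move=> iu fK; have f2 := K2_L2 fK; have u2 := inner_L2 iu.
rewrite dotC_mulr dotCBr//; [|exact: L2_cst|exact: L2_mulz].
suff -> : dotC (fun z => circle_val z * f z) (fun=> at0 u) = 0 by rewrite subr0.
exact: integralC_mulz_H2 (K2_H2 fK) (H2_cst (at0 u)^*).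
Qed.

(** Writing h = h(0) + z B h and using that f is orthogonal to u B h, the pairing of z f with u h
    depends on h(0) alone. Subtracting <f, kt0 u> u cancels it, because <z f, u> = <f, kt0 u> and
    <u, u> = 1, and the subtracted term is orthogonal to K2 u. *)
Lemma SKE u f : inner u -> K2 u f ->
  SK u f = (fun z => circle_val z * f z - dotC f (kt0 u) * u z) %[ae m].
Proof.
move=> iu fK; have f2 := K2_L2 fK; have u2 := inner_L2 iu.
have zfH := H2_mulz (K2_H2 fK); have zf2 := H2_L2 zfH.
have cuH := H2Z (dotC f (kt0 u)) (inner_H2 iu); have cu2 := H2_L2 cuH.
apply: (PK_unique iu) => //; last first.
  move=> g gK; rewrite dotCBl//; last exact: K2_L2 gK.
  by rewrite dotCZl//; [rewrite (K2_orth_u iu gK) mulr0 subr0|exact: K2_L2 gK].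
split; first exact: H2B.
move=> h hH; have h2 := H2_L2 hH; have uhH := inner_H2_mul iu hH; have uh2 := H2_L2 uhH.
rewrite dotCBl// dotCZl//.
have hE : (fun z => u z * h z) = (fun z => at0 h * u z + circle_val z * (u z * bshift h z)).
  by apply/funext => z; rewrite -[in LHS](bshiftK h z); ring.
have ubH := inner_H2_mul iu (bshift_H2 hH); have ub2 := H2_L2 ubH.
have zub2 := L2_mulz ub2.
have key w : L2 w ->
    dotC (fun z => circle_val z * w z) (fun z => circle_val z * (u z * bshift h z)) =
    dotC w (fun z => u z * bshift h z).
  move=> w2; congr integralC; apply/funext => z; rewrite rmorphM /= mulrACA.
  by rewrite circle_mul_conj mul1r.
have split_h w : L2 w -> dotC w (fun z => u z * h z) = (at0 h)^* * dotC w u +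
    dotC w (fun z => circle_val z * (u z * bshift h z)).
  move=> w2; rewrite hE (dotCDr (L2Z (at0 h) u2) zub2 w2).
  by rewrite (dotCZr (at0 h) u2 w2).
rewrite (split_h _ zf2) (split_h _ u2) (key f f2).
have -> : dotC f (fun z => u z * bshift h z) = 0 by case: fK => _; apply; exact: bshift_H2.
have -> : dotC u (fun z => circle_val z * (u z * bshift h z)) = 0.
  have -> : (fun z => circle_val z * (u z * bshift h z)) =
      (fun z => u z * (circle_val z * bshift h z)).
    by apply/funext => z; ring.
  have -> : dotC u (fun z => u z * (circle_val z * bshift h z)) =
     dotC (fun z => u z * 1) (fun z => u z * (circle_val z * bshift h z)).
    by congr dotC; apply/funext => z; rewrite mulr1.
  rewrite dotC_inner_mul//; [|exact: L2_cst|exact/L2_mulz/H2_L2/bshift_H2].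
  rewrite -[RHS]conjC0 -(integralC_mulz_H2 (bshift_H2 hH) (H2_cst 1)) -integralC_conj; last first.
    by apply: L2M; [exact/L2_mulz/H2_L2/bshift_H2|exact: L2_cst].
  by congr integralC; apply/funext => z; rewrite mul1r mulr1.
rewrite !addr0 -dotC_kt0//.
have -> : dotC u u = 1.
  transitivity (dotC (fun _ : T => 1 : C) (fun=> 1)).
    rewrite -(dotC_inner_mul iu (L2_cst 1) (L2_cst 1)).
    by congr dotC; apply/funext => z; rewrite mulr1.
  transitivity (integralC (fun _ : T => 1 : C)); last exact: integralC1.
  by congr integralC; apply/funext => z; rewrite conjC1 mulr1.
by rewrite mulr1 mulrC subrr.
Qed.

End ModelSpace.

(** * Bounded vectors of the model space and powers of the backward shift *)

Section BoundedVectors.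
Variable R : realType.
Local Notation C := R[i].
Local Notation T := (circle R).
Local Notation m := (circle_measure R).
Implicit Types (f g h u v p q : T -> C).

Lemma bounded_aeD f g : bounded_ae f -> bounded_ae g -> bounded_ae (fun z => f z + g z).
Proof.
move=> [M fM] [N gN]; exists (M + N); apply: filterS2 fM gN => z fM gN.
by rewrite (le_trans (normcD_le _ _))// lerD.
Qed.

Lemma bounded_aeM f g : bounded_ae f -> bounded_ae g -> bounded_ae (fun z => f z * g z).
Proof.
move=> [M fM] [N gN]; exists (M * N); apply: filterS2 fM gN => z fM gN.
by rewrite ComplexField.Normc.normcM ler_pM ?normc_ge0.
Qed.

(** In h = h(0) + z B h the second part contributes the integral of z u B h, which is zero. *)
Lemma at0M u h : H2 u -> H2 h -> at0 (fun z => u z * h z) = at0 u * at0 h.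
Proof.
move=> uH hH; have u2 := H2_L2 uH; have h2 := H2_L2 hH.
have zbh2 := L2_mulz (H2_L2 (bshift_H2 hH)).
rewrite [in LHS]/at0 [in LHS]/fourier.
have -> : (fun z => u z * h z * circle_val z ^ (- 0)) =
    (fun z => at0 h * u z + (circle_val z * u z * bshift h z)).
  by apply/funext => z; rewrite oppr0 expr0z -[in LHS](bshiftK h z); ring.
rewrite integralCD; [|exact/L2_L1/L2Z|apply: L2M; [exact: L2_mulz|exact/H2_L2/bshift_H2]].
rewrite integralC_mulz_H2// ?addr0; last exact: bshift_H2.
rewrite integralCZ; last exact: L2_L1.
rewrite mulrC; congr (_ * _); congr integralC; apply/funext => z.
by rewrite oppr0 expr0z mulr1.
Qed.

Lemma at0_mulz h : H2 h -> at0 (fun z => circle_val z * h z) = 0.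
Proof. by move=> [_ h0]; rewrite /at0 fourier_mulz h0. Qed.

Lemma dotC_cst1 f : L2 f -> dotC (fun=> 1) f = (at0 f)^*.
Proof. by move=> f2; rewrite at0E dotC_conj//; exact: L2_cst. Qed.

Lemma dotC_inner_self u h : inner u -> L2 h -> dotC u (fun z => u z * h z) = (at0 h)^*.
Proof.
move=> iu h2; rewrite -dotC_cst1// -(dotC_inner_mul iu (L2_cst 1) h2).
by congr dotC; apply/funext => z; rewrite mulr1.
Qed.

Lemma K2_k0 u : inner u -> K2 u (k0 u).
Proof.
move=> iu; have uH := inner_H2 iu; have u2 := inner_L2 iu.
split; first by apply: H2B; [exact: H2_cst|exact: H2Z].
move=> h hH; have h2 := H2_L2 hH; have uh2 := inner_L2_mul iu h2.
rewrite dotCBl//; [|exact: L2_cst|exact: L2Z].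
rewrite dotCZl// dotC_inner_self// dotC_cst1// at0M// rmorphM /=.
by rewrite subrr.
Qed.

Lemma K2_kt0 u : inner u -> K2 u (kt0 u).
Proof.
move=> iu; have uH := inner_H2 iu; have u2 := inner_L2 iu.
split; first exact: (bshift_H2 uH).
move=> h hH; have h2 := H2_L2 hH.
have zh2 := L2_mulz h2; have uzh2 := inner_L2_mul iu zh2.
rewrite dotC_mulJ.
have -> : (fun z => circle_val z * (u z * h z)) = (fun z => u z * (circle_val z * h z)).
  by apply/funext => z; ring.
rewrite dotCBl//; last exact: L2_cst.
rewrite dotC_inner_self// at0_mulz// conjC0 sub0r.
have := dotCZl (at0 u) (L2_cst 1) uzh2; under eq_fun do rewrite mulr1.
move=> ->; rewrite dotC_cst1// at0M//; last exact: H2_mulz.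
by rewrite at0_mulz// mulr0 conjC0 mulr0 oppr0.
Qed.

Lemma bounded_cst_mul (a : C) f : bounded_ae f -> bounded_ae (fun z => a * f z).
Proof. exact: bounded_aeM (bounded_cst a). Qed.

(* [p] is the projection of z^n onto K2 u, and [q] is a polynomial; this is why
   [p] is bounded. *)
Lemma K2_monomial u n : inner u -> exists p q,
  [/\ K2 u p, bounded_ae p, H2 q & forall z, circle_val z ^+ n = p z + u z * q z].
Proof.
move=> iu; have ub := inner_bounded iu.
elim: n => [|n [p [q [pK pb qH E]]]].
  (* 1 = k0 u + conj(u(0)) u. *)
  exists (k0 u), (fun=> (at0 u)^*); split.
  - exact: K2_k0.
  - have := bounded_aeD (bounded_cst 1) (bounded_cst_mul (- (at0 u)^*) ub).
    by congr bounded_ae; apply/funext => z; rewrite mulNr.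
  - exact: H2_cst.
  - by move=> z; rewrite expr0 /k0; ring.
pose c := dotC p (kt0 u).
(* By [SKE] the new p is S_u of the old one; the multiple of u taken away from z p is added to the
   other component. *)
exists (fun z => circle_val z * p z - c * u z), (fun z => circle_val z * q z + c); split.
- apply: (K2_ae iu) (SKE iu pK); first exact/PK_K2/L2_mulz/K2_L2/pK.
  by apply: L2B; [exact/L2_mulz/K2_L2/pK|exact/L2Z/inner_L2].
- have := bounded_aeD (bounded_aeM (bounded_exprz R 1) pb) (bounded_cst_mul (- c) ub).
  by congr bounded_ae; apply/funext => z; rewrite mulNr.
- by apply: H2D; [exact: H2_mulz|exact: H2_cst].
- by move=> z; rewrite exprS E; ring.
Qed.

Lemma K2_zpoly u c n : inner u -> exists p q,
  [/\ K2 u p, bounded_ae p, H2 q & forall z, zpoly c n z = p z + u z * q z].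
Proof.
move=> iu; elim: n => [|n [p [q [pK pb qH E]]]].
  exists (fun=> 0), (fun=> 0); split.
  - split; first exact: H2_cst.
    by move=> h hH; rewrite dotC0l.
  - exact: bounded_cst.
  - exact: H2_cst.
  - by move=> z; rewrite zpoly0 mulr0 addr0.
have [p' [q' [pK' pb' qH' E']]] := K2_monomial n iu.
exists (fun z => p z + c n * p' z), (fun z => q z + c n * q' z); split.
- by apply: K2D => //; exact: K2Z.
- by apply: bounded_aeD => //; exact: bounded_cst_mul.
- by apply: H2D => //; exact: H2Z.
- by move=> z; rewrite zpolyS E -exprnP E'; ring.
Qed.

(** A Taylor polynomial of f is p + u q with f - p orthogonal to u q, so keeping only the bounded
    component p does not increase the distance to f. *)
Lemma K2_bounded_dense u f (e : R) : inner u -> K2 u f -> 0 < e ->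
  exists p, [/\ K2 u p, bounded_ae p & normL2 (fun z => f z - p z) <= e].
Proof.
move=> iu fK e0; have [N NP] := psum_cvg (K2_H2 fK) e0.
have [p [q [pK pb qH E]]] := K2_zpoly (fun k => fourier f k) N iu.
exists p; split=> //; apply: le_trans (NP N (leqnn N)).
have fpK := K2B iu fK pK; have fp2 := K2_L2 fpK; have uq2 := inner_L2_mul iu (H2_L2 qH).
rewrite (normL2_sym (L2_zpoly _ _) (K2_L2 fK)).
rewrite -(@ler_pXn2r _ 2%N) ?nnegrE ?normL2_ge0//.
have -> : (fun z => f z - psum f N z) = (fun z => (f z - p z) + (-1) * (u z * q z)).
  by apply/funext => z; rewrite /psum E; ring.
have orth : dotC (fun z => f z - p z) (fun z => (-1) * (u z * q z)) = 0.
  by rewrite dotCZr//; have [_ ->] := fpK => //; rewrite mulr0.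
by rewrite (pythagoras fp2 (L2Z (-1) uq2) orth) lerDl sqr_ge0.
Qed.

Lemma fourier_bshift f (n : nat) : L2 f -> fourier (bshift f) n = fourier f n.+1.
Proof.
move=> f2; rewrite fourier_mulzJ fourierB//; last exact: L2_cst.
rewrite fourier_cst (_ : n%:Z + 1 = n.+1%:Z); last by rewrite -addn1 PoszD.
by rewrite mulr0 subr0.
Qed.

Lemma at0_iter_bshift f n : H2 f -> at0 (iter n (@bshift R) f) = fourier f n.
Proof.
elim: n f => // n IHn f fH.
by rewrite iterSr IHn; [exact/fourier_bshift/H2_L2|exact: bshift_H2].
Qed.

Lemma iter_bshiftE f n z : H2 f ->
  circle_val z ^+ n * iter n (@bshift R) f z = f z - psum f n z.
Proof.
move=> fH; elim: n => [|n IHn]; first by rewrite expr0 mul1r /psum zpoly0 subr0.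
rewrite /psum zpolyS opprD addrA -/(psum f n z) -IHn -exprnP.
rewrite -(at0_iter_bshift n fH) iterS exprSr -[in RHS](bshiftK (iter n _ f)).
ring.
Qed.

Lemma normL2_iter_bshift f n : H2 f ->
  normL2 (iter n (@bshift R) f) = normL2 (fun z => psum f n z - f z).
Proof.
move=> fH; rewrite normL2_sym; [|exact: L2_zpoly|exact: H2_L2].
congr Num.sqrt; apply: eq_Rintegral => z _.
by rewrite -iter_bshiftE// ComplexField.Normc.normcM (normc_exprz n z) mul1r.
Qed.

Lemma normL2_iter_bshift_le f n : H2 f -> normL2 (iter n (@bshift R) f) <= normL2 f.
Proof.
move=> fH; have f2 := H2_L2 fH.
rewrite normL2_iter_bshift// normL2_sym//; last exact: L2_zpoly.
rewrite -(@ler_pXn2r _ 2%N) ?nnegrE ?normL2_ge0//.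
have : normL2 (fun z => (f z - psum f n z) + psum f n z) ^+ 2 = _ :=
  pythagoras (L2B f2 (L2_zpoly _ _)) (L2_zpoly _ _) (psum_orth _ f2 (leqnn n)).
by under eq_fun do rewrite subrK; move=> ->; rewrite lerDl sqr_ge0.
Qed.

Lemma K2_iter_bshift u f n : inner u -> K2 u f -> K2 u (iter n (@bshift R) f).
Proof. by move=> iu fK; elim: n => //= n; exact: K2_bshift. Qed.

(** Each use of [mulz_conjK] leaves a multiple of u z^n, to which x is orthogonal. *)
Lemma dotC_zn_conjK u x f n : inner u -> K2 u x -> K2 u f ->
  dotC x (fun z => circle_val z ^+ n * conjK u f z) =
  dotC x (conjK u (iter n (@bshift R) f)).
Proof.
move=> iu xK; have x2 := K2_L2 xK.
elim: n f => [|n IHn] f fK.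
  by congr dotC; apply/funext => z; rewrite expr0 mul1r.
have f2 := K2_L2 fK; have bK := K2_bshift iu fK.
rewrite iterSr -IHn//.
have znH := H2_exprn R n.
have uzn2 := inner_L2_mul iu (H2_L2 znH).
have zcb2 : L2 (fun z => circle_val z ^+ n * conjK u (bshift f) z).
  apply: L2_bounded_mul; [exact: (measurableC_exprz R n)|exact: (bounded_exprz R n)|].
  exact/conjK_L2/K2_L2/bK.
have -> : (fun z => circle_val z ^+ n.+1 * conjK u f z) =
    (fun z => circle_val z ^+ n * conjK u (bshift f) z + (at0 f)^* * (u z * circle_val z ^+ n)).
  apply/funext => z; rewrite exprSr -mulrA mulz_conjK; ring.
rewrite dotCDr//; last exact: L2Z.
by rewrite dotCZr//; have [_ ->] := xK => //; rewrite mulr0 addr0.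
Qed.

End BoundedVectors.

(** * Decomposition of the model space along a factorization of the inner function *)

Section Factorization.
Variable R : realType.
Local Notation C := R[i].
Local Notation T := (circle R).
Local Notation m := (circle_measure R).
Implicit Types (f g h x : T -> C).

Section Splitting.
Variables (u v w : T -> C).
Hypotheses (iu : inner u) (iv : inner v) (iw : inner w).
Hypothesis wE : w = (fun z => u z * v z) %[ae m].

Let dotC_w f x : L2 f -> L2 x ->
  dotC f (fun z => w z * x z) = dotC f (fun z => u z * (v z * x z)).
Proof.
move=> f2 x2; apply: dotC_aeR => //.
- exact: inner_L2_mul.
- by apply: inner_L2_mul => //; exact: inner_L2_mul.
- by apply: filterS wE => z /(_ I) -> _; rewrite mulrA.
Qed.

Lemma K2_mul_orth g h : K2 u g -> H2 h -> dotC g (fun z => u z * h z) = 0.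
Proof. by case=> _ go; exact: go. Qed.

(** The factors stay abstract because both orders occur: theta = alpha beta decomposes nu, and theta
    = beta alpha decomposes the space containing chi. *)
Lemma K2_mul_add g h : K2 u g -> K2 v h -> K2 w (fun z => g z + u z * h z).
Proof.
move=> gK hK; have gH := K2_H2 gK; have hH := K2_H2 hK.
have uhH := inner_H2_mul iu hH.
split; first exact: H2D.
move=> x xH; have x2 := H2_L2 xH; have vxH := inner_H2_mul iv xH.
rewrite dotC_w//; last exact/H2_L2/H2D.
have uvx2 := inner_L2_mul iu (H2_L2 vxH).
rewrite (dotCDl (H2_L2 gH) (H2_L2 uhH) uvx2) K2_mul_orth// add0r.
rewrite (dotC_inner_mul iu (H2_L2 hH) (H2_L2 vxH)).
by case: hK => _; exact.
Qed.

(** Take for h the H2 projection of conj(u) f: then f - u h is orthogonal to u H2, and h is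
    orthogonal to v H2 because f is orthogonal to u v H2. *)
Lemma K2_mul_split f : K2 w f -> exists g h, [/\ K2 u g, K2 v h &
  forall z, f z = g z + u z * h z].
Proof.
move=> fK; have f2 := K2_L2 fK; have uf2 := inner_L2_mulJ iu f2.
have [h hH ho] := H2_proj_ex uf2; have h2 := H2_L2 hH.
have ho' x : H2 x -> dotC (fun z => (u z)^* * f z) x = dotC h x.
  by move=> xH; have := ho x xH; rewrite (dotCBl uf2 h2 (H2_L2 xH)) => /subr0_eq.
have uhH := inner_H2_mul iu hH; have uh2 := H2_L2 uhH.
exists (fun z => f z - u z * h z), h; split; last by move=> z; rewrite subrK.
  split; first by apply: H2B => //; exact: K2_H2 fK.
  move=> x xH; have ux2 := inner_L2_mul iu (H2_L2 xH).
  rewrite (dotCBl f2 uh2 ux2) (dotC_inner_mul iu h2 (H2_L2 xH)) -ho'// dotC_mulJ.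
  by rewrite subrr.
split=> // x xH; rewrite -ho'; last exact: inner_H2_mul.
by rewrite dotC_mulJ -dotC_w//; [case: fK => _; exact|exact: H2_L2].
Qed.

Lemma PK_split f g h : K2 u g -> K2 v h -> f = (fun z => g z + u z * h z) %[ae m] ->
  L2 f -> PK u f = g %[ae m] /\ PK v (fun z => (u z)^* * f z) = h %[ae m].
Proof.
move=> gK hK fE f2; have g2 := K2_L2 gK; have h2 := K2_L2 hK.
have uh2 := inner_L2_mul iu h2; have guh2 := L2D g2 uh2.
split.
  apply: (PK_unique iu) => // x xK; have x2 := K2_L2 xK.
  rewrite (dotC_aeL f2 guh2 x2 fE) (dotCDl g2 uh2 x2).
  rewrite -(dotC_conj x2 uh2) K2_mul_orth ?conjC0 ?addr0//; exact: K2_H2 hK.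
apply: (PK_unique iv) => //; first exact: inner_L2_mulJ.
move=> x xK; have x2 := K2_L2 xK; have ux2 := inner_L2_mul iu x2.
rewrite dotC_mulJ (dotC_aeL f2 guh2 ux2 fE) (dotCDl g2 uh2 ux2).
by rewrite (dotC_inner_mul iu h2 x2) K2_mul_orth ?add0r//; exact: K2_H2 xK.
Qed.

Lemma at0_inner_mul : at0 w = at0 u * at0 v.
Proof.
rewrite -(at0M (inner_H2 iu) (inner_H2 iv)); apply: fourier_ae => //.
  exact: inner_measurable.
exact/L2_measurable/inner_L2_mul/inner_L2.
Qed.

(** Divide u v - u(0) v(0) = v(0) (u - u(0)) + u (v - v(0)) by z. *)
Lemma kt0_inner_mul :
  kt0 w = (fun z => at0 v * kt0 u z + u z * kt0 v z) %[ae m].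
Proof.
apply: filterS wE => z /(_ I) wz _; rewrite /kt0 wz at0_inner_mul; ring.
Qed.

End Splitting.

Lemma conjK_kt0 (u : T -> C) : inner u -> conjK u (kt0 u) = k0 u %[ae m].
Proof.
move=> iu; apply: filterS (inner_mulJ iu) => z uz _.
rewrite /conjK /kt0 /k0 mulrA circle_mul_conj mul1r rmorphB /= mulrBr uz.
by rewrite mulrC.
Qed.

(** This legitimates the denominator of c: a null kt0 u would make u equal to u(0) almost
    everywhere. *)
Lemma normL2_kt0_neq0 (u : T -> C) : inner u -> nonconstant u -> normL2 (kt0 u) != 0.
Proof.
move=> iu nu; apply/eqP => /(normL2_eq0 (K2_L2 (K2_kt0 iu))) H; apply: nu.
exists (at0 u); apply: filterS H => z /(_ I) kz _.
have : circle_val z * kt0 u z = 0 by rewrite kz mulr0.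
by rewrite /kt0 mulrA circle_mul_conj mul1r => /subr0_eq.
Qed.

End Factorization.

(** * Asymmetric truncated Toeplitz operators *)

Section Toeplitz.
Variable R : realType.
Local Notation C := R[i].
Local Notation T := (circle R).
Local Notation m := (circle_measure R).
Implicit Types (f g h x p F G : T -> C).
Variables (alpha theta : T -> C) (A : (T -> C) -> (T -> C)).
Hypotheses (ia : inner alpha) (it : inner theta).
Hypothesis bA : bounded_operator (K2 theta) (K2 alpha) A.

Lemma normL2_eq0_le f (K : R) : L2 f ->
  (forall e : R, 0 < e -> normL2 f <= K * e) -> f = (fun=> 0) %[ae m].
Proof.
move=> f2 H; apply: normL2_eq0 => //.
have : (normL2 f)%:C%C = 0 :> C.
  apply: (@normc_eq0_le _ _ K) => e e0.
  by rewrite normc_real ger0_norm ?normL2_ge0// H.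
by case.
Qed.

Lemma bounded_operator_sub X f g : bounded_operator (K2 theta) (K2 alpha) X ->
  K2 theta f -> K2 theta g ->
  (fun z => X f z - X g z) = X (fun z => f z - g z) %[ae m].
Proof.
move=> [_ Xae Xlin _] fK gK; have fgK := K2B it fK gK.
(* Linearity is given for combinations a f + g, so the difference is reached through f = 1 (f - g) +
   g. *)
have H := Xlin 1 _ _ fgK gK.
have sK : K2 theta (fun z => 1 * (f z - g z) + g z).
  by under eq_fun do rewrite mul1r subrK.
have E : X (fun z => 1 * (f z - g z) + g z) = X f %[ae m].
  by apply: Xae => //; apply: aeW => z _; rewrite mul1r subrK.
apply: filterS2 H E => z /(_ I) H /(_ I) E _.
by rewrite -E H mul1r addrK.
Qed.

Lemma bounded_operator_sub_le X : bounded_operator (K2 theta) (K2 alpha) X ->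
  exists2 M : R, 0 <= M & forall f g, K2 theta f -> K2 theta g ->
  normL2 (fun z => X f z - X g z) <= M * normL2 (fun z => f z - g z).
Proof.
move=> bX; have [XK _ _ [M XM]] := bX; exists `|M| => // f g fK gK.
have fgK := K2B it fK gK.
rewrite (normL2_ae _ _ (bounded_operator_sub bX fK gK)).
- by rewrite (le_trans (XM _ fgK))// ler_wpM2r ?normL2_ge0 ?ler_norm.
- exact/L2_measurable/L2B/K2_L2/XK/gK/K2_L2/XK/fK.
- exact/L2_measurable/K2_L2/XK/fgK.
Qed.

Section Symbol.
Variable phi : T -> C.
Hypothesis phi2 : L2 phi.
Hypothesis formA : forall f g, K2 theta f -> K2 alpha g -> bounded_ae g ->
  dotC (A f) g = dotC f (fun z => (phi z)^* * g z).

(** [formA] tests only bounded g. On the domain phi f is in L2, so both sides are continuous in g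
    and density of the bounded vectors of K2 alpha finishes. *)
Lemma TTO_eq f : TTO_dom theta phi f -> TTO alpha phi f = A f %[ae m].
Proof.
move=> [fK pf2]; have [AK _ _ _] := bA; have AfK := AK _ fK; have Af2 := K2_L2 AfK.
apply: (PK_unique ia) => // g gK; have g2 := K2_L2 gK.
apply/subr0_eq; rewrite -(dotCBl pf2 Af2 g2).
have d2 := L2B pf2 Af2.
apply: (@normc_eq0_le _ _ (normL2 (fun z => phi z * f z - A f z))) => e e0.
have [p [pK pb gp]] := K2_bounded_dense ia gK e0; have p2 := K2_L2 pK.
have dp : dotC (fun z => phi z * f z - A f z) p = 0.
  rewrite (dotCBl pf2 Af2 p2) formA//; apply/eqP; rewrite subr_eq0; apply/eqP.
  by congr integralC; apply/funext => z; rewrite rmorphM /= conjCK; ring.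
rewrite -[dotC _ g]subr0 -[X in _ - X]dp -(dotCBr g2 p2 d2).
rewrite (le_trans (CauchySchwarz d2 (L2B g2 p2)))//.
by rewrite ler_wpM2l// normL2_ge0.
Qed.

Lemma TTO_dom_lin (a : C) f g : TTO_dom theta phi f -> TTO_dom theta phi g ->
  TTO_dom theta phi (fun z => a * f z + g z).
Proof.
move=> [fK pf2] [gK pg2]; split; first by apply: K2D => //; exact: K2Z.
have -> : (fun z => phi z * (a * f z + g z)) = (fun z => a * (phi z * f z) + phi z * g z).
  by apply/funext => z; ring.
by apply: L2D => //; exact: L2Z.
Qed.

Lemma TTO_dom_bounded f : K2 theta f -> bounded_ae f -> TTO_dom theta phi f.
Proof.
move=> fK fb; split => //; under eq_fun do rewrite mulrC.
by apply: L2_bounded_mul => //; exact/L2_measurable/K2_L2/fK.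
Qed.

Lemma is_TTO_of_form : is_TTO theta alpha phi A.
Proof.
have [AK Aae Alin [M AM]] := bA.
have domK f : TTO_dom theta phi f -> K2 theta f by case.
have tK f : TTO_dom theta phi f -> K2 alpha (TTO alpha phi f).
  by move=> [fK pf2]; exact: PK_K2.
split=> //.
- split => //.
  + move=> f g fd gd fg; have fK := domK _ fd; have gK := domK _ gd.
    by apply: filterS3 (TTO_eq fd) (TTO_eq gd) (Aae _ _ fK gK fg)
      => z /(_ I) -> /(_ I) -> /(_ I) ->.
  + move=> a f g fd gd; have fK := domK _ fd; have gK := domK _ gd.
    apply: filterS2 (filterI (TTO_eq fd) (TTO_eq gd))
        (filterI (TTO_eq (TTO_dom_lin a fd gd)) (Alin a _ _ fK gK))
      => z [/(_ I) Ef /(_ I) Eg] [/(_ I) E1 /(_ I) E2] _.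
    by rewrite E1 E2 Ef Eg.
  + exists M => f fd; have fK := domK _ fd.
    rewrite (normL2_ae _ _ (TTO_eq fd)); [exact: AM| |].
      exact/L2_measurable/K2_L2/tK/fd.
    exact/L2_measurable/K2_L2/AK/fK.
- split=> // f fd; apply: filterS (TTO_eq fd) => z /(_ I) ->.
  by [].
(* Bounded vectors lie in the domain and are dense in K2 theta, so two bounded extensions
   coincide. *)
- move=> B [bB BT] f fK.
  have [N N0 BN] := bounded_operator_sub_le bB.
  have [L L0 AL] := bounded_operator_sub_le bA.
  have [BK _ _ _] := bB.
  have Af2 := K2_L2 (AK _ fK); have Bf2 := K2_L2 (BK _ fK).
  suff : (fun z => B f z - A f z) = (fun=> 0) %[ae m].
    by apply: filterS => z /(_ I)/subr0_eq.
  apply: (@normL2_eq0_le _ (N + L)); first exact: L2B.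
  move=> e e0; have [p [pK pb fp]] := K2_bounded_dense it fK e0.
  have pd := TTO_dom_bounded pK pb.
  have Bp2 := K2_L2 (BK _ pK); have Ap2 := K2_L2 (AK _ pK).
  have BAp : B p = A p %[ae m].
    by apply: filterS2 (BT p pd) (TTO_eq pd) => z /(_ I) -> /(_ I).
  have -> : normL2 (fun z => B f z - A f z) =
      normL2 (fun z => (B f z - B p z) - (A f z - A p z)).
    apply: normL2_ae; [exact/L2_measurable/L2B| |].
      by apply/L2_measurable; apply: L2B; exact: L2B.
    by apply: filterS BAp => z /(_ I) -> _; ring.
  rewrite (le_trans (normL2B (L2B Bf2 Bp2) (L2B Af2 Ap2)))// mulrDl lerD//.
    by rewrite (le_trans (BN _ _ fK pK))// ler_wpM2l.
  by rewrite (le_trans (AL _ _ fK pK))// ler_wpM2l.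
Qed.

End Symbol.

Variables (mu nu : T -> C).
Hypotheses (muK : K2 alpha mu) (nuK : K2 theta nu).
Hypothesis eqA : forall f x, K2 theta f -> K2 alpha x ->
  dotC (A f) x - dotC (A (SK theta f)) (SK alpha x) =
  dotC f (kt0 theta) * dotC mu x + dotC f nu * dotC (kt0 alpha) x.

(** By [dotC_kt0] this is the pairing of z C_u f = u conj(f) with u, and |u| = 1 leaves the integral
    of conj(f). *)
Lemma dotC_conjK_kt0 u f : inner u -> K2 u f -> dotC (conjK u f) (kt0 u) = (at0 f)^*.
Proof.
move=> iu fK; have f2 := K2_L2 fK; have cK := K2_conjK iu fK.
rewrite dotC_kt0// -dotC_cst1//.
rewrite -(dotC_inner_mul iu (L2_cst 1) f2).
transitivity (dotC (fun z => u z * (f z)^*) u).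
  congr integralC; apply/funext => z; rewrite /conjK rmorphM /=.
  transitivity ((circle_val z * (circle_val z)^*) * (u z * (f z)^* * (u z)^*)); first by ring.
  by rewrite circle_mul_conj mul1r.
have uf2 := inner_L2_mul iu (L2_conj f2).
transitivity (dotC (fun z => u z * (f z)^*) (fun z => u z * 1)).
  by congr dotC; apply/funext => z; rewrite mulr1.
rewrite (dotC_inner_mul iu (L2_conj f2) (L2_cst 1)) (dotC_inner_mul iu (L2_cst 1) f2).
by congr integralC; apply/funext => z; rewrite conjC1 mulr1 mul1r.
Qed.

(** Both conjugations being antilinear, this is antilinear in F and linear in G; hence the
    conjugates on the coefficients of F only. *)
Definition form F G := dotC (A (conjK theta F)) (conjK alpha G).

Lemma form_step F G : K2 theta F -> K2 alpha G ->
  form F G = (at0 F)^* * dotC mu (conjK alpha G) +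
             at0 G * dotC (conjK theta F) nu + form (bshift F) (bshift G).
Proof.
move=> FK GK; have cF := K2_conjK it FK; have cG := K2_conjK ia GK.
have [AK Aae _ _] := bA.
have bF := K2_conjK it (K2_bshift it FK); have bG := K2_conjK ia (K2_bshift ia GK).
have sF := PK_K2 it (L2_mulz (K2_L2 cF)); have sG := PK_K2 ia (L2_mulz (K2_L2 cG)).
have : form F G - _ = _ := eqA cF cG; rewrite dotC_conjK_kt0//.
rewrite -(dotC_conj (K2_L2 cG) (K2_L2 (K2_kt0 ia))) dotC_conjK_kt0// conjCK.
have -> : dotC (A (SK theta (conjK theta F))) (SK alpha (conjK alpha G)) =
    form (bshift F) (bshift G).
  apply: dotC_ae.
  - exact/L2_measurable/K2_L2/AK/sF.
  - exact/L2_measurable/K2_L2/AK/bF.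
  - exact/L2_measurable/K2_L2/sG.
  - exact/L2_measurable/K2_L2/bG.
  - by apply: Aae => //; exact: SK_conjK.
  - exact: SK_conjK.
by move/eqP; rewrite subr_eq => /eqP ->; rewrite [dotC _ nu * _]mulrC.
Qed.

Lemma form_iter F G n : K2 theta F -> K2 alpha G ->
  form F G = \sum_(k < n) ((fourier F k)^* * dotC mu (fun z => circle_val z ^+ k * conjK alpha G z)
     + fourier G k * (dotC nu (fun z => circle_val z ^+ k * conjK theta F z))^*)
   + form (iter n (@bshift R) F) (iter n (@bshift R) G).
Proof.
move=> FK GK; elim: n => [|n IHn]; first by rewrite big_ord0 add0r.
have FnK := K2_iter_bshift n it FK; have GnK := K2_iter_bshift n ia GK.
rewrite IHn big_ord_recr /= -addrA; congr (_ + _).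
rewrite form_step// (at0_iter_bshift n (K2_H2 FK)) (at0_iter_bshift n (K2_H2 GK)).
rewrite (dotC_zn_conjK n ia muK GK) (dotC_zn_conjK n it nuK FK).
by rewrite dotC_conj//; [exact: K2_L2 nuK|exact/K2_L2/K2_conjK].
Qed.

Lemma L2_mul_bounded f g : L2 f -> L2 g -> bounded_ae g -> L2 (fun z => f z * (g z)^*).
Proof.
move=> f2 g2 gb; under eq_fun do rewrite mulrC.
apply: L2_bounded_mul => //; first exact/measurableC_conj/L2_measurable.
by have [M gM] := gb; exists M; apply: filterS gM => z; rewrite normc_conj.
Qed.

(** Boundedness of F and G makes mu conj(C_alpha G) and nu conj(C_theta F) square integrable, so the
    finite sums become L2 pairings that can pass to the limit. *)
Lemma form_psum F G n : K2 theta F -> K2 alpha G -> bounded_ae F -> bounded_ae G ->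
  form F G = dotC (fun z => mu z * (conjK alpha G z)^*) (psum F n)
    + (dotC (fun z => nu z * (conjK theta F z)^*) (psum G n))^*
    + form (iter n (@bshift R) F) (iter n (@bshift R) G).
Proof.
move=> FK GK Fb Gb; rewrite (form_iter n FK GK); congr (_ + _).
have cF := K2_conjK it FK; have cG := K2_conjK ia GK.
have h1 := L2_mul_bounded (K2_L2 muK) (K2_L2 cG) (bounded_conjK ia Gb).
have h2 := L2_mul_bounded (K2_L2 nuK) (K2_L2 cF) (bounded_conjK it Fb).
rewrite !dotC_zpoly// rmorph_sum /= -big_split /=; apply: eq_bigr => k _.
congr (_ * _ + _).
  rewrite fourierE; congr integralC; apply/funext => z.
  by rewrite rmorphM /= -exprnP; ring.
rewrite rmorphM /= conjCK; congr (_ * _^*).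
rewrite fourierE; congr integralC; apply/funext => z.
by rewrite rmorphM /= -exprnP; ring.
Qed.

Lemma form_bounded F G : K2 theta F -> K2 alpha G -> bounded_ae F -> bounded_ae G ->
  form F G = dotC (fun z => mu z * (conjK alpha G z)^*) F
    + (dotC (fun z => nu z * (conjK theta F z)^*) G)^*.
Proof.
move=> FK GK Fb Gb.
have cF := K2_conjK it FK; have cG := K2_conjK ia GK.
have h1 := L2_mul_bounded (K2_L2 muK) (K2_L2 cG) (bounded_conjK ia Gb).
have h2 := L2_mul_bounded (K2_L2 nuK) (K2_L2 cF) (bounded_conjK it Fb).
have F2 := K2_L2 FK; have G2 := K2_L2 GK.
set b1 := fun z => mu z * _; set b2 := fun z => nu z * _.
have [AK _ _ [M AM]] := bA.
apply/subr0_eq.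
apply: (@normc_eq0_le _ _ (normL2 b1 + normL2 b2 + `|M| * normL2 G)) => e e0.
have [N1 N1P] := psum_cvg (K2_H2 FK) e0; have [N2 N2P] := psum_cvg (K2_H2 GK) e0.
pose n := maxn N1 N2.
have Fn := N1P n (leq_maxl _ _); have Gn := N2P n (leq_maxr _ _).
rewrite (form_psum n FK GK Fb Gb) -/b1 -/b2.
have pF := L2_zpoly (fun k => fourier F k) n; have pG := L2_zpoly (fun k => fourier G k) n.
have FnK := K2_iter_bshift n it FK; have GnK := K2_iter_bshift n ia GK.
set r := form _ _.
have -> : dotC b1 (psum F n) + (dotC b2 (psum G n))^* + r - (dotC b1 F + (dotC b2 G)^*) =
    dotC b1 (fun z => psum F n z - F z) + (dotC b2 (fun z => psum G n z - G z))^* + r.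
  by rewrite (dotCBr pF F2 h1) (dotCBr pG G2 h2) rmorphB /=; ring.
rewrite !mulrDl.
rewrite (le_trans (normcD_le _ _))// lerD//.
  rewrite (le_trans (normcD_le _ _))// lerD//.
    rewrite (le_trans (CauchySchwarz h1 (L2B pF F2)))//.
    by rewrite ler_wpM2l// normL2_ge0.
  rewrite normc_conj (le_trans (CauchySchwarz h2 (L2B pG G2)))//.
  by rewrite ler_wpM2l// normL2_ge0.
have cFn := K2_conjK it FnK; have cGn := K2_conjK ia GnK.
rewrite (le_trans (CauchySchwarz (K2_L2 (AK _ cFn)) (K2_L2 cGn)))//.
(* Only the factor coming from F has to be small; the one from G is bounded by the norm of G. *)
rewrite (normL2_conjK ia (K2_L2 GnK)) mulrAC ler_pM ?normL2_ge0//; last first.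
  exact: normL2_iter_bshift_le (K2_H2 GK).
rewrite (le_trans (AM _ cFn))// (normL2_conjK it (K2_L2 FnK)).
rewrite (normL2_iter_bshift n (K2_H2 FK)).
by rewrite (le_trans (ler_wpM2r (normL2_ge0 _) (ler_norm M)))// ler_wpM2l.
Qed.

Lemma L2_conj_mul f g : L2 f -> L2 g -> bounded_ae g -> L2 (fun z => (f z)^* * g z).
Proof.
move=> f2 g2 gb; under eq_fun do rewrite mulrC.
by apply: L2_bounded_mul => //; [exact: L2_measurable|exact: L2_conj].
Qed.

Definition symbol : T -> C := fun z => conjK alpha nu z + (conjK theta mu z)^*.

Lemma L2_symbol : L2 symbol.
Proof.
apply: L2D; first exact/conjK_L2/K2_L2/nuK.
exact/L2_conj/conjK_L2/K2_L2/muK.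
Qed.

Lemma symbol_form_bounded f g : K2 theta f -> K2 alpha g -> bounded_ae f -> bounded_ae g ->
  dotC (A f) g = dotC f (fun z => (symbol z)^* * g z).
Proof.
move=> fK gK fb gb.
pose F := conjK theta f; pose G := conjK alpha g.
have FK : K2 theta F by exact: K2_conjK.
have GK : K2 alpha G by exact: K2_conjK.
have Fb : bounded_ae F by exact: bounded_conjK.
have Gb : bounded_ae G by exact: bounded_conjK.
have FE : conjK theta F = f %[ae m] by exact: conjKK.
have GE : conjK alpha G = g %[ae m] by exact: conjKK.
have cF := K2_conjK it FK; have cG := K2_conjK ia GK.
have [AK Aae _ _] := bA.
have f2 := K2_L2 fK; have g2 := K2_L2 gK; have F2 := K2_L2 FK; have G2 := K2_L2 GK.
have cF2 := K2_L2 cF; have cG2 := K2_L2 cG.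
transitivity (form F G).
  apply: dotC_ae; try exact: L2_measurable.
  - exact/L2_measurable/K2_L2/AK.
  - exact/L2_measurable/K2_L2/AK.
  - by apply: ae_eq_sym; exact: Aae.
  - exact: ae_eq_sym.
rewrite form_bounded//.
have h1 := L2_mul_bounded (K2_L2 muK) cG2 (bounded_conjK ia Gb).
have h2 := L2_mul_bounded (K2_L2 nuK) cF2 (bounded_conjK it Fb).
rewrite (dotC_conj h2 G2) /dotC -integralCD; [|exact: L1_dotC..].
have sg2 := L2_conj_mul L2_symbol g2 gb.
apply: integralC_ae.
- by apply: measurableC_add; apply/L1_measurable; exact: L1_dotC.
- by apply/L1_measurable; exact: L1_dotC.
apply: filterS2 FE GE => z /(_ I) fz /(_ I) gz _.
by rewrite fz gz /symbol /F /G /conjK !(rmorphM, rmorphD) /= !conjCK; ring.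
Qed.

(** Both sides are continuous in f: A is bounded, and conj(phi) g is in L2 as g is bounded. *)
Lemma symbol_form f g : K2 theta f -> K2 alpha g -> bounded_ae g ->
  dotC (A f) g = dotC f (fun z => (symbol z)^* * g z).
Proof.
move=> fK gK gb.
have f2 := K2_L2 fK; have g2 := K2_L2 gK.
have [AK _ _ _] := bA.
have [M M0 AM] := bounded_operator_sub_le bA.
have sg2 := L2_conj_mul L2_symbol g2 gb.
apply/subr0_eq.
apply: (@normc_eq0_le _ _ (M * normL2 g + normL2 (fun z => (symbol z)^* * g z))) => e e0.
have [p [pK pb fp]] := K2_bounded_dense it fK e0; have p2 := K2_L2 pK.
have Af2 := K2_L2 (AK _ fK); have Ap2 := K2_L2 (AK _ pK).
have Ep := symbol_form_bounded pK gK pb gb.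
have -> : dotC (A f) g - dotC f (fun z => (symbol z)^* * g z) =
   dotC (fun z => A f z - A p z) g + dotC (fun z => p z - f z) (fun z => (symbol z)^* * g z).
  by rewrite (dotCBl Af2 Ap2 g2) (dotCBl p2 f2 sg2) Ep; ring.
rewrite (le_trans (normcD_le _ _))// mulrDl lerD//.
  rewrite (le_trans (CauchySchwarz (L2B Af2 Ap2) g2))// mulrAC.
  by rewrite ler_wpM2r ?normL2_ge0// (le_trans (AM _ _ fK pK))// ler_wpM2l.
rewrite (le_trans (CauchySchwarz (L2B p2 f2) sg2))// mulrC ler_wpM2l ?normL2_ge0//.
by rewrite normL2_sym.
Qed.

Lemma is_TTO_symbol phi : L2 phi -> phi = symbol %[ae m] -> is_TTO theta alpha phi A.
Proof.
move=> phi2 phiE; apply: is_TTO_of_form => // f g fK gK gb.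
have g2 := K2_L2 gK.
rewrite symbol_form//; apply: dotC_aeR.
- exact: K2_L2 fK.
- exact: L2_conj_mul L2_symbol g2 gb.
- exact: L2_conj_mul phi2 g2 gb.
- by apply: filterS phiE => z /(_ I) ->.
Qed.

End Toeplitz.

(** * The operator equation as an identity between inner products *)

Section EquationInnerForm.
Variable R : realType.
Local Notation C := R[i].
Local Notation T := (circle R).
Local Notation m := (circle_measure R).
Implicit Types (f g x : T -> C).
Variables (alpha theta : T -> C) (A : (T -> C) -> (T -> C)) (mu nu : T -> C).
Hypotheses (ia : inner alpha) (it : inner theta).
Hypothesis bA : bounded_operator (K2 theta) (K2 alpha) A.
Hypotheses (muK : K2 alpha mu) (nuK : K2 theta nu).
Hypothesis eqA : forall f, K2 theta f ->
  (fun z => A f z - adjoint (K2 alpha) (SK alpha) (A (SK theta f)) z)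
  = (fun z => rank1 mu (kt0 theta) f z + rank1 (kt0 alpha) nu f z) %[ae m].

(* For every c the pair (mu + c^* kt0 alpha, nu - c kt0 theta) defines the same
   operator of rank two as (mu, nu). *)
Lemma equation_dotC (c : C) f x : K2 theta f -> K2 alpha x ->
  dotC (A f) x - dotC (A (SK theta f)) (SK alpha x) =
  dotC f (kt0 theta) * dotC (fun z => mu z + c^* * kt0 alpha z) x +
  dotC f (fun z => nu z - c * kt0 theta z) * dotC (kt0 alpha) x.
Proof.
move=> fK xK; have f2 := K2_L2 fK; have x2 := K2_L2 xK.
have [AK _ _ _] := bA.
have sK := PK_K2 it (L2_mulz f2); have sxK := PK_K2 ia (L2_mulz x2).
have AsK := AK _ sK; have As2 := K2_L2 AsK; have Af2 := K2_L2 (AK _ fK).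
have [adK adE] := adjoint_SK ia AsK; have ad2 := K2_L2 adK.
have mu2 := K2_L2 muK; have nu2 := K2_L2 nuK.
have ka2 := K2_L2 (K2_kt0 ia); have kt2 := K2_L2 (K2_kt0 it).
have -> : dotC (A (SK theta f)) (SK alpha x) =
    dotC (adjoint (K2 alpha) (SK alpha) (A (SK theta f))) x.
  by rewrite -(dotC_conj (K2_L2 sxK) As2) (adE x xK) dotC_conj.
rewrite -(dotCBl Af2 ad2 x2).
have r1 := L2Z (dotC f (kt0 theta)) mu2; have r2 := L2Z (dotC f nu) ka2.
rewrite (dotC_aeL (L2B Af2 ad2) (L2D r1 r2) x2 (eqA fK)) (dotCDl r1 r2 x2).
rewrite (dotCZl _ mu2 x2) (dotCZl _ ka2 x2).
rewrite (dotCDl mu2 (L2Z _ ka2) x2) (dotCZl _ ka2 x2).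
(* The two terms conj(c) <f, kt0 theta> <kt0 alpha, x> cancel. *)
rewrite (dotCBr nu2 (L2Z _ kt2) f2) (dotCZr _ kt2 f2); ring.
Qed.

End EquationInnerForm.

(** * The choice of c and the explicit formulas for psi and chi *)

Theorem theorem8p5 (R : realType) (alpha theta : circle R -> R[i])
    (A : (circle R -> R[i]) -> (circle R -> R[i]))
    (mu nu : circle R -> R[i]) :
  let beta := inner_quot theta alpha in
  inner alpha -> nonconstant alpha ->
  inner theta -> nonconstant theta ->
  inner_divides alpha theta -> nonconstant beta ->
  bounded_operator (K2 theta) (K2 alpha) A ->
  K2 alpha mu -> K2 theta nu ->
  (forall f, K2 theta f ->
     (fun z => A f z - adjoint (K2 alpha) (SK alpha) (A (SK theta f)) z)
     = (fun z => rank1 mu (kt0 theta) f z + rank1 (kt0 alpha) nu f z)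
     %[ae circle_measure R]) ->
  let w := PK beta (fun z => (alpha z)^* * nu z) in
  let c := dotC w (kt0 beta) * ((normL2 (kt0 beta) ^- 2)%:C)%C in
  let psi := conjK alpha (PK alpha (fun z => nu z - c * kt0 theta z)) in
  let chi := fun z =>
    SK beta (PK beta (fun y => (alpha y)^* * (nu y - c * kt0 theta y))) z
    + beta z * conjK alpha (fun y => mu y + c^* * kt0 alpha y) z in
  [/\ is_TTO theta alpha (fun z => psi z + (chi z)^*) A,
      K2 alpha psi
      /\ psi = (fun z => conjK alpha (PK alpha nu) z
                         - c^* * (at0 beta)^* * k0 alpha z)
         %[ae circle_measure R],
      K2 theta chi
      /\ chi = (fun z => (SK beta w z + c * at0 beta * k0 beta z)
                         + beta z * (conjK alpha mu z + c * k0 alpha z))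
         %[ae circle_measure R]
    & (* K2 theta is the orthogonal direct sum of K2 beta and beta K2 alpha *)
      [/\ forall g h, K2 beta g -> K2 alpha h ->
            K2 theta (fun z => g z + beta z * h z),
          forall f, K2 theta f -> exists g h, [/\ K2 beta g, K2 alpha h &
            f = (fun z => g z + beta z * h z) %[ae circle_measure R]]
        & forall g h, K2 beta g -> K2 alpha h ->
            dotC g (fun z => beta z * h z) = 0]].
Proof.
move=> beta ia _ it _ ab nb bA muK nuK eqA w c psi chi.
have ib : inner beta := ab.
have muL := K2_L2 muK; have nuL := K2_L2 nuK.
have kbK := K2_kt0 ib; have kb2 := K2_L2 kbK.
have kaK := K2_kt0 ia; have ka2 := K2_L2 kaK.
have ktK := K2_kt0 it; have kt2 := K2_L2 ktK.
have k0aK := K2_k0 ia; have k0bK := K2_k0 ib.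
have thetaE : theta = (fun z => alpha z * beta z) %[ae circle_measure R].
  by apply: filterS (inner_mulJ ia) => z az _; rewrite /beta /inner_quot mulrA az mul1r.
have thetaE' : theta = (fun z => beta z * alpha z) %[ae circle_measure R].
  by apply: filterS thetaE => z /(_ I) -> _; rewrite mulrC.
pose nu' := fun z => nu z - c * kt0 theta z.
pose mu' := fun z => mu z + c^* * kt0 alpha z.
have nu'K : K2 theta nu' by apply: K2B => //; exact: K2Z.
have mu'K : K2 alpha mu' by apply: K2D => //; exact: K2Z.
have nu'2 := K2_L2 nu'K.
have [nu1 [nu2 [nu1K nu2K nuE]]] := K2_mul_split ia ib it thetaE nuK.
have nuE' : nu = (fun z => nu1 z + alpha z * nu2 z) %[ae circle_measure R].
  by apply: aeW => z _; exact: nuE.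
have [Pnu wE] := PK_split ia ib nu1K nu2K nuE' nuL.
rewrite -/w in wE.
(* The components of nu' = d1 + alpha d2, read off from [kt0_inner_mul]. *)
pose d1 := fun z => nu1 z - c * at0 beta * kt0 alpha z.
pose d2 := fun z => nu2 z - c * kt0 beta z.
have d1K : K2 alpha d1 by apply: K2B => //; exact: K2Z.
have d2K : K2 beta d2 by apply: K2B => //; exact: K2Z.
have nu'E : nu' = (fun z => d1 z + alpha z * d2 z) %[ae circle_measure R].
  apply: filterS (kt0_inner_mul ia ib it thetaE) => z /(_ I) kz _.
  by rewrite /nu' /d1 /d2 nuE kz; ring.
have [Pd1 Pd2] := PK_split ia ib d1K d2K nu'E nu'2.
have w2 : K2 beta w by exact/PK_K2/inner_L2_mulJ.
(* d2 is w minus its projection on the line of kt0 beta; this is what the value of c achieves. *)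
have d2orth : dotC d2 (kt0 beta) = 0.
  have nu22 := K2_L2 nu2K.
  rewrite (dotCBl nu22 (L2Z c kb2) kb2) (dotCZl c kb2 kb2) dotCff//.
  rewrite -(dotC_aeL (K2_L2 w2) nu22 kb2 wE) /c -mulrA -rmorphM /=.
  rewrite mulVf ?mulr1 ?subrr// expf_neq0//.
  exact: normL2_kt0_neq0.
pose Q := PK beta (fun z => (alpha z)^* * nu' z).
have chiE : chi = fun z => SK beta Q z + beta z * conjK alpha mu' z by [].
have QE : Q = d2 %[ae circle_measure R] by exact: Pd2.
have QK : K2 beta Q by exact/PK_K2/inner_L2_mulJ.
have dQ : dotC Q (kt0 beta) = 0.
  by rewrite (dotC_aeL (K2_L2 QK) (K2_L2 d2K) kb2 QE) d2orth.
have SQE : SK beta Q = (fun z => circle_val z * d2 z) %[ae circle_measure R].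
  apply: filterS2 (SKE ib QK) QE => z /(_ I) -> /(_ I) Qz _.
  by rewrite dQ mul0r subr0 Qz.
have SQK : K2 beta (SK beta Q) by exact/PK_K2/L2_mulz/K2_L2/QK.
have chiK : K2 theta chi.
  by rewrite chiE; apply: (K2_mul_add ib ia it thetaE') => //; exact: K2_conjK.
have psiK : K2 alpha psi by exact/K2_conjK/PK_K2.
split.
- apply: (is_TTO_symbol ia it bA mu'K nu'K).
  + by move=> f x fK xK; exact: equation_dotC.
  + by apply: L2D; [exact: K2_L2 psiK|exact/L2_conj/K2_L2/chiK].
  + apply: filterS3 (filterI thetaE nu'E) (filterI Pd1 (inner_mulJ ia)) SQE
      => z [/(_ I) tz /(_ I) nz] [/(_ I) pz az] /(_ I) sz _.
    rewrite chiE /psi /symbol /conjK sz pz nz tz.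
    move: az (mu' z) (d1 z) (d2 z) (beta z); move: (alpha z) => a az m1 n1 n2 b.
    (* The part conj(z d2) of conj(chi) has to become alpha conj(z alpha d2), so the factor 1 =
       alpha conj(alpha) is inserted before [ring]. *)
    rewrite !(rmorphM, rmorphD) /= !conjCK -[X in _ + (X + _)]mul1r -az; ring.
- split=> //.
  apply: filterS3 (conjK_kt0 ia) Pd1 Pnu => z /(_ I) <- /(_ I) pz /(_ I) nz _.
  rewrite /psi /conjK pz nz /d1.
  by rewrite !(rmorphM, rmorphB) /=; ring.
- split=> //.
  (* As z kt0 beta = beta - beta(0), z Q is z w - c (beta - beta(0)). Tested on K2 beta, the
     function beta vanishes and 1 acts as k0 beta. *)
  have E1 : SK beta Q = (fun z => SK beta w z + c * at0 beta * k0 beta z) %[ae circle_measure R].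
    have SwK : K2 beta (SK beta w) by exact/PK_K2/L2_mulz/K2_L2/w2.
    apply: (PK_unique ib); first exact/L2_mulz/K2_L2/QK.
      by apply: K2D => //; exact: K2Z.
    move=> g gK; have g2 := K2_L2 gK; have one2 := L2_cst (1 : R[i]).
    have zw2 := L2_mulz (K2_L2 w2); have b2 := inner_L2 ib.
    have aux : (fun z => circle_val z * Q z) =
        (fun z => circle_val z * w z - c * (beta z - at0 beta * 1)) %[ae circle_measure R].
      apply: filterS2 QE wE => z /(_ I) -> /(_ I) -> _; rewrite /d2 mulrBr; congr (_ - _).
      rewrite mulrCA /kt0; congr (_ * _).
      by rewrite mulrA circle_mul_conj mul1r mulr1.
    have bb2 := L2B b2 (L2Z (at0 beta) one2).
    rewrite (dotC_aeL (L2_mulz (K2_L2 QK)) (L2B zw2 (L2Z c bb2)) g2 aux).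
    rewrite (dotCBl zw2 (L2Z c bb2) g2) (dotCZl c bb2 g2).
    rewrite (dotCBl b2 (L2Z _ one2) g2) (dotCZl _ one2 g2) (K2_orth_u ib gK).
    have k2 := K2_L2 k0bK.
    rewrite (dotCDl (K2_L2 SwK) (L2Z _ k2) g2) (dotCZl _ k2 g2).
    rewrite (dotCBl one2 (L2Z _ b2) g2) (dotCZl _ b2 g2) (K2_orth_u ib gK).
    by rewrite (dotC_PK ib zw2 gK); ring.
  apply: filterS2 E1 (conjK_kt0 ia) => z /(_ I) sz /(_ I) kz _.
  rewrite chiE /mu' sz -kz /conjK.
  move: (kt0 alpha z) (SK beta w z) (k0 beta z) (beta z) (at0 beta) (c) => k s kb b b0 c0.
  by rewrite rmorphM rmorphD !rmorphM /= conjCK; ring.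
split.
- by move=> g h gK hK; exact: (K2_mul_add ib ia it thetaE').
- move=> f fK; have [g [h [gK hK fE]]] := K2_mul_split ib ia it thetaE' fK.
  by exists g, h; split => //; apply: aeW => z _; exact: fE.
- by move=> g h gK hK; apply: K2_mul_orth => //; exact: K2_H2 hK.
Qed.
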